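(* Let $\Theta$ be a unicritical finite Blaschke product with $\deg\Theta=n$. Then: (i) if $n\ge3$, $W(S_\Theta)$ contains a pseudohyperbolic disk of radius $\cos(\tfrac{\pi}{4})=\tfrac{1}{\sqrt2}$; (ii) if $n\ge4$, $W(S_\Theta)$ contains a pseudohyperbolic disk of radius $\cos(\tfrac{\pi}{5})=\tfrac14(1+\sqrt5)$.
   Context: $\mathbb{D}$ is the open unit disk and $\mathbb{T}$ the unit circle. A unicritical finite Blaschke product of degree $n\ge 1$ is a function $\Theta(z)=\lambda\left(\frac{z-z_0}{1-\bar z_0 z}\right)^n$ with $z_0\in\mathbb{D}$, $\lambda\in\mathbb{T}$. For a finite Blaschke product $\Theta$, $K_\Theta = H^2\ominus \Theta H^2$, where $H^2=H^2(\mathbb{D})$ is the Hardy space. The compression of the shift is $S_\Theta = P_\Theta M_z|_{K_\Theta}$, where $P_\Theta$ is the orthogonal projection of $H^2$ onto $K_\Theta$ and $M_z$ is multiplication by $z$. The numerical range of an operator $A$ is $W(A)=\{\langle Ax,x\rangle : \|x\|=1\}$. A pseudohyperbolic disk of radius $r\in(0,1)$ is a set of the form $D_\rho(w_0,r) = \{z\in\mathbb{D} : |\frac{z-w_0}{1-\bar w_0 z}|<r\}$ for some $w_0\in\mathbb{D}$. *)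

(* Defs.v *)
From Stdlib Require Import Reals.
From Coquelicot Require Import Coquelicot.

Local Open Scope C_scope.

Definition in_disk (z : C) : Prop := Cmod z < 1.

(** Functions on the disk are total functions [C -> C] of which only the values
    on the disk matter: every notion below depends only on those values. *)

Definition is_taylor (f : C -> C) (a : nat -> C) : Prop :=
  forall z : C, in_disk z ->
    is_pseries (K := C_AbsRing) (V := C_NormedModule) a z (f z).

Definition square_summable (a : nat -> C) : Prop :=
  ex_series (fun k : nat => (Cmod (a k) ^ 2)%R).

Definition H2 (f : C -> C) : Prop :=
  exists a : nat -> C, is_taylor f a /\ square_summable a.

(** [is_inner f g l]: [f] and [g] are in [H2] and their inner product (linear in
    [f], conjugate-linear in [g]) is [l].  The Taylor coefficients, hence [l],
    are determined by [f] and [g]. *)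
Definition is_inner (f g : C -> C) (l : C) : Prop :=
  exists a b : nat -> C,
    (is_taylor f a /\ square_summable a) /\
    (is_taylor g b /\ square_summable b) /\
    is_series (K := C_AbsRing) (V := C_NormedModule)
      (fun k : nat => a k * Cconj (b k)) l.

(** Orthogonal complement in [H2]: [H2] minus [E]. *)
Definition ominus (E : (C -> C) -> Prop) (f : C -> C) : Prop :=
  H2 f /\ forall g : C -> C, E g -> is_inner f g 0.

(** [Theta] times [H2]; for a finite Blaschke product it is contained in [H2]. *)
Definition multiples (Theta h : C -> C) : Prop :=
  exists g : C -> C, H2 g /\ forall z : C, in_disk z -> h z = Theta z * g z.

Definition model_space (Theta : C -> C) : (C -> C) -> Prop :=
  ominus (multiples Theta).

(** [is_proj E f p]: [p] is the orthogonal projection of [f] onto the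
    subspace [E] of [H2]. *)
Definition is_proj (E : (C -> C) -> Prop) (f p : C -> C) : Prop :=
  E p /\ forall g : C -> C, E g -> is_inner (fun z : C => f z - p z) g 0.

Definition mult_z (f : C -> C) : C -> C := fun z : C => z * f z.

(** Operators on (a subspace of) [H2] are given by their graphs: this is the
    graph of the compression of the shift, with domain [model_space Theta]. *)
Definition compressed_shift (Theta f g : C -> C) : Prop :=
  model_space Theta f /\ is_proj (model_space Theta) (mult_z f) g.

(** [is_inner x x 1] is the normalization: the square of the norm is 1. *)
Definition numerical_range (A : (C -> C) -> (C -> C) -> Prop) (w : C) : Prop :=
  exists x y : C -> C, A x y /\ is_inner x x 1 /\ is_inner y x w.

Definition unicritical_blaschke (n : nat) (Theta : C -> C) : Prop :=
  (1 <= n)%nat /\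
  exists lambda z0 : C, Cmod lambda = 1%R /\ in_disk z0 /\
    forall z : C, in_disk z ->
      Theta z = lambda * ((z - z0) / (1 - Cconj z0 * z)) ^ n.

Definition pseudohyperbolic_disk (w0 : C) (r : R) (z : C) : Prop :=
  in_disk z /\ Cmod ((z - w0) / (1 - Cconj w0 * z)) < r.

Definition contains_pseudohyperbolic_disk (W : C -> Prop) (r : R) : Prop :=
  0 < r < 1 /\
  exists w0 : C, in_disk w0 /\
    forall z : C, pseudohyperbolic_disk w0 r z -> W z.

(* Main.v *)
Require Import Defs.
From Stdlib Require Import Reals Lra Lia.
From Coquelicot Require Import Coquelicot.

(** With [b] the Blaschke factor of [z0], the functions [b^k / (1 - conj z0 z)],
    [k < n], form an orthogonal basis of the model space, in which the compressed
    shift is [z0 + (1 - |z0|^2) (J - conj z0 J^2 + conj z0^2 J^3 - ...)] for the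
    nilpotent Jordan block [J]; hence the range for [n] contains the one for [m <= n].
    By Toeplitz-Hausdorff it is enough to bound the support function of the range in
    each direction [e] from below by that of a disk.  The substitution
    [x = (1 + conj z0 J) v] makes the resulting Hermitian form tridiagonal, so this
    reduces to the sign of a determinant.  For [m = 3] the disk whose diameter is the
    intersection of the range with the line through [0] and [z0] works, and its
    pseudohyperbolic radius [rho] satisfies
    [2 rho / (1 + rho^2) = sqrt (8 + |z0|^2) / 3], which gives (i), and also (ii) as
    soon as [|z0|^2 >= 5/8].  For smaller [z0] and [m = 4] an explicit disk is used. *)

Local Open Scope R_scope.

(** * Disks and convex sets in the plane *)

(** At [z0 = 0] the operator is the Jordan block [J], whose numerical range in size [m] is the disk
    of radius [cos (PI / (m + 1))] about 0. Both radii are therefore reached there without slack,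
    and the trial disks have to be right to first order in [z0]. Size 3 proves too little for (ii)
    near 0, since its radius starts at [cos (PI / 4)] and grows with [|z0|]; hence the case split.
    Containing a disk is a lower bound on the range, so one test vector per direction is enough. It
    exists as soon as a determinant is nonpositive, because the Hermitian form is then not positive
    definite; no eigenvalue is computed. The trial disks are centred on the line of [z0], so their
    support in direction [e] is affine in [Re (conj e z0)], and each determinant inequality involves
    two real variables. *)

Lemma Cmod_sqr (z : C) : Cmod z ^ 2 = fst z ^ 2 + snd z ^ 2.
Proof. unfold Cmod. rewrite pow2_sqrt; [reflexivity | nra]. Qed.

Lemma Cmod_lt_sqr (z : C) (a : R) : 0 < a -> fst z ^ 2 + snd z ^ 2 < a ^ 2 -> Cmod z < a.
Proof.
  intros Ha H. rewrite <- Cmod_sqr in H. pose proof (Cmod_ge_0 z). nra.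
Qed.

(** The pseudohyperbolic disk about [w0] is a Euclidean disk with centre
    [(1 - r^2) w0 / (1 - r^2 |w0|^2)] and radius [r (1 - |w0|^2) / (1 - r^2 |w0|^2)]. Here
    [w0 = t Z] is chosen so that this centre is [Z]; the last hypothesis says that the radius is at
    most [rho]. *)
Lemma pseudohyperbolic_disk_in_disk (Z : C) (rho r : R) :
  0 < r < 1 -> 0 < rho < 1 -> Cmod Z < 1 ->
  r * (1 - Cmod Z ^ 2 + rho ^ 2) <= rho * (1 + r ^ 2) ->
  exists w0 : C, in_disk w0 /\
    forall z : C, pseudohyperbolic_disk w0 r z -> Cmod (z - Z) < rho.
Proof.
  intros Hr Hrho HZ Hle.
  assert (Hk1 : Cmod Z ^ 2 < 1) by (pose proof (Cmod_ge_0 Z); nra).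
  rewrite Cmod_sqr in Hle, Hk1. destruct Z as [a b]; simpl fst in *; simpl snd in *.
  set (k := a ^ 2 + b ^ 2) in *.
  assert (Hk0 : 0 <= k) by (unfold k; nra).
  assert (Hr2 : 0 < 1 - r ^ 2) by nra.
  assert (Hdisc : 0 < (1 - r ^ 2) ^ 2 + 4 * r ^ 2 * k).
  { assert (0 < (1 - r ^ 2) ^ 2) by (apply pow_lt; auto). nra. }
  set (D := sqrt ((1 - r ^ 2) ^ 2 + 4 * r ^ 2 * k)).
  assert (HD0 : 0 <= D) by apply sqrt_pos.
  assert (HD : D * D = (1 - r ^ 2) ^ 2 + 4 * r ^ 2 * k) by (apply sqrt_sqrt; lra).
  (* Positive root of the centre condition [r^2 k t^2 + (1 - r^2) t = 1], in the form that stays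
     valid for [k = 0]. *)
  set (t := 2 / ((1 - r ^ 2) + D)).
  assert (Ht0 : 0 < t) by (apply Rdiv_lt_0_compat; lra).
  assert (Ht : r ^ 2 * k * t ^ 2 + (1 - r ^ 2) * t = 1).
  { replace (r ^ 2 * k) with ((D * D - (1 - r ^ 2) ^ 2) / 4) by (rewrite HD; field).
    unfold t; field; lra. }
  clearbody t D.
  assert (Hkab : k = a ^ 2 + b ^ 2) by reflexivity. clearbody k.
  set (m := t ^ 2 * k).
  assert (Hm0 : 0 <= m) by (unfold m; nra).
  assert (Hm1 : m < 1).
  { destruct (Rlt_or_le m 1) as [H|H]; auto. exfalso.
    assert (t <= 1) by (unfold m in H; nra).
    assert (t ^ 2 <= 1) by nra. unfold m in H. nra. }
  set (h := (1 - r ^ 2) * t) in *.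
  assert (Hh0 : 0 < h) by (apply Rmult_lt_0_compat; auto).
  assert (Hh : h = 1 - r ^ 2 * m) by (unfold m; lra).
  set (rho' := r * (1 - m) / h).
  assert (Hrho'0 : 0 < rho') by (apply Rdiv_lt_0_compat; nra).
  assert (Hrho' : rho' * h = r * (1 - m)) by (unfold rho'; field; lra).
  assert (Hk : h * h * k = (1 - r ^ 2) ^ 2 * m) by (unfold h, m; ring).
  assert (Hrho'1 : rho' < 1) by nra.
  assert (Heq : rho' * (1 + r ^ 2) = r * (1 - k + rho' ^ 2)).
  { apply Rmult_eq_reg_l with (h * h); [|nra].
    replace (h * h * (rho' * (1 + r ^ 2))) with (h * (rho' * h) * (1 + r ^ 2)) by ring.
    replace (h * h * (r * (1 - k + rho' ^ 2)))
      with (r * (h * h - h * h * k + (rho' * h) ^ 2)) by ring.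
    rewrite Hk, Hrho', Hh. ring. }
  (* [Heq] is the hypothesis with equality, and [x (1 + r^2) - r (1 - k + x^2)] increases on
     [[0, 1]]. *)
  assert (Hrr : rho' <= rho).
  { destruct (Rle_or_lt rho' rho) as [H|H]; auto. exfalso.
    assert (r * (rho' + rho) < 1 + r ^ 2) by nra. nra. }
  exists (t * a, t * b)%R. split.
  - apply Cmod_lt_sqr; [lra|]. simpl fst; simpl snd.
    replace ((t * a) ^ 2 + (t * b) ^ 2) with m by (unfold m; rewrite Hkab; ring). lra.
  - intros z [Hz Hlt].
    set (den := (1 - Cconj (t * a, t * b)%R * z)%C) in Hlt.
    assert (Hden : den <> 0%C).
    { intros H0. assert (Hm : Cmod (Cconj (t * a, t * b)%R * z) = 1).
      { replace (Cconj (t * a, t * b)%R * z)%C with (1 - den)%C by (unfold den; ring).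
        rewrite H0. replace (1 - 0)%C with (RtoC 1) by ring. apply Cmod_1. }
      rewrite Cmod_mult, Cmod_conj in Hm.
      assert (Cmod (t * a, t * b)%R < 1).
      { apply Cmod_lt_sqr; [lra|]. simpl fst; simpl snd.
        replace ((t * a) ^ 2 + (t * b) ^ 2) with m by (unfold m; rewrite Hkab; ring). lra. }
      unfold in_disk in Hz. pose proof (Cmod_ge_0 z).
      pose proof (Cmod_ge_0 (t * a, t * b)%R). nra. }
    rewrite Cmod_div in Hlt by auto.
    pose proof (Cmod_gt_0 den) as Hg. apply Hg in Hden. clear Hg.
    apply Rlt_div_l in Hlt; auto.
    pose proof (Cmod_ge_0 (z - (t * a, t * b)%R)) as Hnum.
    assert (Hsq : Cmod (z - (t * a, t * b)%R) ^ 2 < r ^ 2 * Cmod den ^ 2) by nra.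
    rewrite !Cmod_sqr in Hsq. unfold den in Hsq. destruct z as [x y].
    simpl fst in Hsq; simpl snd in Hsq.
    apply Cmod_lt_sqr; [lra|]. simpl fst; simpl snd.
    apply Rlt_le_trans with (rho' ^ 2); [|nra].
    apply Rmult_lt_reg_l with (h * h); [nra|].
    replace (h * h * rho' ^ 2) with (r ^ 2 * (1 - m) ^ 2)
      by (replace (h * h * rho' ^ 2) with ((rho' * h) ^ 2) by ring; rewrite Hrho'; ring).
    assert (Hin : h * (x ^ 2 + y ^ 2) - 2 * h * (a * x + b * y) + m - r ^ 2 < 0).
    { rewrite Hh at 1. unfold h, m. rewrite Hkab. nra. }
    assert (Hfin : h * (h * ((x + - a) ^ 2 + (y + - b) ^ 2)) =
      h * (h * (x ^ 2 + y ^ 2) - 2 * h * (a * x + b * y)) + h * h * k)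
      by (rewrite Hkab; ring).
    replace (h * h * ((x + - a) ^ 2 + (y + - b) ^ 2))
      with (h * (h * ((x + - a) ^ 2 + (y + - b) ^ 2))) by ring.
    rewrite Hfin, Hk.
    assert (h * (h * (x ^ 2 + y ^ 2) - 2 * h * (a * x + b * y)) < h * (r ^ 2 - m))
      by (apply Rmult_lt_compat_l; lra).
    replace (r ^ 2 * (1 - m) ^ 2) with (h * (r ^ 2 - m) + (1 - r ^ 2) ^ 2 * m)
      by (rewrite Hh; ring). lra.
Qed.

Definition convex_C (W : C -> Prop) : Prop :=
  forall (p q : C) (s : R), W p -> W q -> 0 <= s <= 1 ->
    W ((1 - s) * fst p + s * fst q, (1 - s) * snd p + s * snd q).

Definition dot (p q : C) : R := fst p * fst q + snd p * snd q.

Lemma Cmod_unit (z : C) : Cmod z <> 0 ->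
  exists e : C, dot e e = 1 /\ fst z = Cmod z * fst e /\ snd z = Cmod z * snd e.
Proof.
  intros Hz. exists (fst z / Cmod z, snd z / Cmod z)%R.
  unfold dot; simpl. pose proof (Cmod_sqr z).
  repeat split; try (field; auto).
  replace (fst z / Cmod z * (fst z / Cmod z) + snd z / Cmod z * (snd z / Cmod z))
    with ((fst z ^ 2 + snd z ^ 2) / Cmod z ^ 2) by (field; auto).
  rewrite <- H. field; auto.
Qed.

(* A point of [W] at distance at least [eta] from [w] can be moved towards a point of
   [W] in the opposite direction so that the squared distance drops by a fixed amount. *)
Lemma convex_approx (W : C -> Prop) (w : C) (d M eta : R) :
  convex_C W -> 0 < d -> 0 < eta ->
  (forall e : C, dot e e = 1 ->
     exists p : C, W p /\ Cmod (p - w) <= M /\ d <= dot e (p - w)) ->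
  exists p : C, W p /\ Cmod (p - w) < eta.
Proof.
  intros HW Hd Heta Hdir.
  destruct (Hdir (1, 0)%R) as (p0 & Hp0 & HM0 & Hd0).
  { unfold dot; simpl; ring. }
  assert (HM : 0 < M).
  { apply Rlt_le_trans with d; auto.
    apply Rle_trans with (Cmod (p0 - w)); auto.
    pose proof (Cmod_sqr (p0 - w)). pose proof (Cmod_ge_0 (p0 - w)).
    unfold dot in Hd0; cbn [fst snd] in Hd0. nra. }
  set (drop := (d * eta / (2 * M)) ^ 2).
  assert (Hdrop : 0 < drop).
  { unfold drop. apply pow_lt. apply Rdiv_lt_0_compat; nra. }
  assert (Hdesc : forall k : nat,
    (exists p : C, W p /\ Cmod (p - w) < eta) \/
    (exists p : C, W p /\ Cmod (p - w) ^ 2 <= M ^ 2 - INR k * drop)).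
  { induction k as [|k [IH|(p & Hp & Hle)]]; [right|left; auto|].
    - exists p0. split; auto. simpl INR. pose proof (Cmod_ge_0 (p0 - w)). nra.
    - destruct (Rlt_or_le (Cmod (p - w)) eta) as [Hlt|Hge]; [left; eauto|right].
      destruct (Cmod_unit (p - w)) as (e & He & He1 & He2); [lra|].
      destruct (Hdir (Copp e)) as (q & Hq & HqM & Hqd).
      { rewrite <- He. unfold dot; simpl; ring. }
      pose proof (Cmod_sqr (p - w)) as Hp2. pose proof (Cmod_sqr (q - w)) as Hq2.
      pose proof (Cmod_ge_0 (q - w)).
      assert (HkD : 0 <= INR k * drop) by (apply Rmult_le_pos; [apply pos_INR|lra]).
      set (l := Cmod (p - w)) in *. set (l' := Cmod (q - w)) in *.
      (* Minimiser of [s^2 (2 M)^2 - 2 s d eta], which bounds the change of the squared distance;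
         the minimum is [- drop]. *)
      set (s := d * eta / (2 * M) ^ 2).
      assert (HlM : l <= M) by nra.
      assert (Hdot : dot (p - w) (q - w) <= - (d * l)).
      { unfold dot in *. rewrite He1, He2. simpl fst in *; simpl snd in *. nra. }
      assert (HdM : d <= M).
      { unfold dot in *. simpl fst in *; simpl snd in *.
        assert (l' ^ 2 >= d ^ 2); [|nra].
        rewrite Hq2.
        set (u1 := fst q + - fst w) in *. set (u2 := snd q + - snd w) in *.
        assert ((u1 ^ 2 + u2 ^ 2) * (fst e * fst e + snd e * snd e) =
          (- fst e * u1 + - snd e * u2) ^ 2 + (fst e * u2 - snd e * u1) ^ 2) by ring.
        rewrite He in H0. pose proof (pow2_ge_0 (fst e * u2 - snd e * u1)). nra. }
      assert (Hs : 0 <= s <= 1).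
      { unfold s. split. apply Rle_div_r; nra. apply Rle_div_l; nra. }
      exists ((1 - s) * fst p + s * fst q, (1 - s) * snd p + s * snd q)%R.
      split; [apply HW; auto|].
      set (p' := ((1 - s) * fst p + s * fst q, (1 - s) * snd p + s * snd q)%R).
      assert (Hexp : Cmod (p' - w) ^ 2 =
        (1 - s) ^ 2 * l ^ 2 + 2 * s * (1 - s) * dot (p - w) (q - w) + s ^ 2 * l' ^ 2).
      { rewrite Hp2, Hq2, (Cmod_sqr (p' - w)). unfold p', dot. simpl. ring. }
      rewrite Hexp, S_INR.
      assert (Hsd : 2 * s * (d * eta) - s ^ 2 * (2 * M) ^ 2 = drop).
      { unfold s, drop. field. lra. }
      assert (s * (1 - s) * dot (p - w) (q - w) <= s * (1 - s) * - (d * l)).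
      { apply Rmult_le_compat_l; auto. apply Rmult_le_pos; lra. }
      assert (s * (d * eta) <= s * (d * l)) by (apply Rmult_le_compat_l; nra).
      assert (s ^ 2 * l' ^ 2 <= s ^ 2 * M ^ 2).
      { apply Rmult_le_compat_l; [apply pow2_ge_0|]. nra. }
      assert (s ^ 2 * l ^ 2 <= s ^ 2 * M ^ 2).
      { apply Rmult_le_compat_l; [apply pow2_ge_0|]. nra. }
      assert (s ^ 2 * (d * l) <= s ^ 2 * M ^ 2).
      { apply Rmult_le_compat_l; [apply pow2_ge_0|]. nra. }
      assert (0 <= s * l ^ 2) by (apply Rmult_le_pos; nra).
      nra. }
  destruct (archimed_cor1 (drop / (M ^ 2 + 1))) as (N & HN & HN0).
  { apply Rdiv_lt_0_compat; nra. }
  destruct (Hdesc N) as [H|(p & _ & H)]; auto. exfalso.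
  pose proof (pow2_ge_0 (Cmod (p - w))).
  assert (0 < INR N) by (apply lt_0_INR; lia).
  assert (M ^ 2 + 1 < INR N * drop); [|nra].
  apply Rmult_lt_reg_l with (/ INR N); [apply Rinv_0_lt_compat; auto|].
  rewrite <- Rmult_assoc, Rinv_l, Rmult_1_l by lra.
  apply Rmult_lt_reg_r with (/ (M ^ 2 + 1)); [apply Rinv_0_lt_compat; nra|].
  rewrite Rmult_assoc, Rinv_r, Rmult_1_r by nra. exact HN.
Qed.

Lemma Cmod_dot_le (e z : C) : dot e e = 1 -> Rabs (dot e z) <= Cmod z.
Proof.
  intros He.
  apply Rsqr_incr_0_var; [|apply Cmod_ge_0].
  rewrite <- Rsqr_abs. unfold Rsqr.
  replace (Cmod z * Cmod z) with (Cmod z ^ 2) by ring. rewrite Cmod_sqr.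
  replace (fst z ^ 2 + snd z ^ 2) with (dot e e * (fst z ^ 2 + snd z ^ 2)) by (rewrite He; ring).
  unfold dot. pose proof (pow2_ge_0 (fst e * snd z - snd e * fst z)). nra.
Qed.

Lemma convex_vertical (W : C -> Prop) (w p q : C) :
  convex_C W -> W p -> W q -> fst q < fst w < fst p ->
  exists s : R, 0 <= s <= 1 /\
    W (fst w, (1 - s) * snd p + s * snd q)%R.
Proof.
  intros HW Hp Hq H.
  exists ((fst p - fst w) / (fst p - fst q)).
  assert (Hs : 0 <= (fst p - fst w) / (fst p - fst q) <= 1).
  { split; [apply Rle_div_r|apply Rle_div_l]; lra. }
  split; auto.
  replace (fst w) with
    ((1 - (fst p - fst w) / (fst p - fst q)) * fst p + (fst p - fst w) / (fst p - fst q) * fst q)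
    at 1 by (field; lra).
  apply HW; auto.
Qed.

Lemma convex_quadrants (W : C -> Prop) (w pp np nn pn : C) :
  convex_C W -> W pp -> W np -> W nn -> W pn ->
  fst pp > fst w -> snd pp > snd w -> fst np < fst w -> snd np > snd w ->
  fst nn < fst w -> snd nn < snd w -> fst pn > fst w -> snd pn < snd w -> W w.
Proof.
  intros HW W1 W2 W3 W4 A1 B1 A2 B2 A3 B3 A4 B4.
  destruct (convex_vertical W w pp np) as (s & Hs & Hup); auto.
  destruct (convex_vertical W w pn nn) as (t & Ht & Hlo); auto.
  set (u := (1 - s) * snd pp + s * snd np) in *.
  set (l := (1 - t) * snd pn + t * snd nn) in *.
  assert (Hu : snd w < u) by (unfold u; destruct (Rle_or_lt s (1 / 2)); nra).
  assert (Hl : l < snd w) by (unfold l; destruct (Rle_or_lt t (1 / 2)); nra).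
  replace w with
    ((1 - (u - snd w) / (u - l)) * fst (fst w, u) + (u - snd w) / (u - l) * fst (fst w, l),
     (1 - (u - snd w) / (u - l)) * snd (fst w, u) + (u - snd w) / (u - l) * snd (fst w, l))%R.
  - apply HW; auto. split; [apply Rle_div_r|apply Rle_div_l]; lra.
  - clearbody u l. clear - Hu Hl. destruct w as [a b]; simpl in *.
    f_equal; field; lra.
Qed.

(** Support bounds place the disk in the closure of [W]. To reach [w] itself, the four diagonal
    shifts of [w] by [d] are approximated to within [d], so that the approximants lie in the four
    open quadrants at [w]. *)
Lemma disk_in_convex (W : C -> Prop) (Z : C) (rho M : R) :
  convex_C W ->
  (forall p : C, W p -> Cmod p <= M) ->
  (forall e : C, dot e e = 1 -> exists p : C, W p /\ dot e Z + rho <= dot e p) ->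
  forall w : C, Cmod (w - Z) < rho -> W w.
Proof.
  intros HW HM Hdir w Hw.
  (* The shifted points are within [2 d] of [w], which leaves support at least [4 d - 2 d >= d]
     around each of them. *)
  set (d := (rho - Cmod (w - Z)) / 4).
  assert (Hd : 0 < d) by (unfold d; lra).
  assert (Happ : forall a b : R, a ^ 2 = 1 -> b ^ 2 = 1 ->
    exists p : C, W p /\ Cmod (p - (fst w + d * a, snd w + d * b)%R) < d).
  { intros a b Ha Hb. set (w' := (fst w + d * a, snd w + d * b)%R).
    assert (Hw' : Cmod (w' - w) < 2 * d).
    { apply Cmod_lt_sqr; [lra|]. unfold w'; simpl.
      replace ((fst w + d * a + - fst w) * ((fst w + d * a + - fst w) * 1) +
        (snd w + d * b + - snd w) * ((snd w + d * b + - snd w) * 1))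
        with (d * d * (a ^ 2 + b ^ 2)) by ring. rewrite Ha, Hb. nra. }
    apply convex_approx with d (M + Cmod w'); auto.
    intros e He. destruct (Hdir e He) as (p & Hp & Hpd). exists p.
    split; [|split]; auto.
    - unfold Cminus. apply Rle_trans with (1 := Cmod_triangle _ _).
      rewrite Cmod_opp. specialize (HM p Hp). lra.
    - pose proof (Cmod_dot_le e (w' - w) He) as H1.
      pose proof (Cmod_dot_le e (w - Z) He) as H2.
      pose proof (Rle_abs (dot e (w' - w))). pose proof (Rle_abs (dot e (w - Z))).
      replace (dot e (p - w')) with
        (dot e p - dot e Z - dot e (w - Z) - dot e (w' - w))
        by (unfold dot; simpl; ring).
      unfold d in *. lra. }
  assert (Hquad : forall a b : R, a ^ 2 = 1 -> b ^ 2 = 1 ->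
    exists p : C, W p /\ 0 < a * (fst p - fst w) /\ 0 < b * (snd p - snd w)).
  { intros a b Ha Hb. destruct (Happ a b Ha Hb) as (p & Hp & Hlt). exists p.
    pose proof (Cmod_ge_0 (p - (fst w + d * a, snd w + d * b)%R)).
    assert (Hsq : Cmod (p - (fst w + d * a, snd w + d * b)%R) ^ 2 < d ^ 2) by nra.
    rewrite Cmod_sqr in Hsq. simpl fst in Hsq; simpl snd in Hsq.
    assert (Ha' : a = 1 \/ a = -1) by (assert ((a - 1) * (a + 1) = 0) by lra;
      apply Rmult_integral in H0; lra).
    assert (Hb' : b = 1 \/ b = -1) by (assert ((b - 1) * (b + 1) = 0) by lra;
      apply Rmult_integral in H0; lra).
    assert (Hpos : forall u v, (u - d) ^ 2 + v ^ 2 < d ^ 2 -> 0 < u).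
    { intros u v Huv. apply Rnot_le_lt; intros Hu. nra. }
    split; auto. split.
    - apply (Hpos _ (snd p - (snd w + d * b))). clear - Hsq Ha'.
      destruct Ha' as [-> | ->]; lra.
    - apply (Hpos _ (fst p - (fst w + d * a))). clear - Hsq Hb'.
      destruct Hb' as [-> | ->]; lra. }
  destruct (Hquad 1 1) as (pp & ? & ? & ?); try ring.
  destruct (Hquad (-1) 1) as (np & ? & ? & ?); try ring.
  destruct (Hquad (-1) (-1)) as (nn & ? & ? & ?); try ring.
  destruct (Hquad 1 (-1)) as (pn & ? & ? & ?); try ring.
  apply (convex_quadrants W w pp np nn pn); auto; lra.
Qed.

(** * Determinant inequalities *)

(* For [T = |z0|^2] and [y = Re (conj e z0)], the form to be studied in direction [e] is
   Hermitian tridiagonal with diagonal [chain_diag, ..., chain_diag, mu] and off-diagonal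
   entries of squared modulus [chain_off]; [chain2] and [chain3] are its leading minors,
   [pencil3] and [pencil4] its determinants in sizes 3 and 4. *)
Definition chain_diag (T y mu : R) : R := mu * (1 + T) - 2 * y.
Definition chain_off (T y mu : R) : R := 1 - 2 * mu * y + mu ^ 2 * T.
Definition chain2 (T y mu : R) : R := chain_diag T y mu ^ 2 - chain_off T y mu.
Definition chain3 (T y mu : R) : R :=
  chain_diag T y mu * chain2 T y mu - chain_off T y mu * chain_diag T y mu.
Definition pencil3 (T y mu : R) : R :=
  mu * chain2 T y mu - chain_off T y mu * chain_diag T y mu.
Definition pencil4 (T y mu : R) : R :=
  mu * chain3 T y mu - chain_off T y mu * chain2 T y mu.

(** In the two directions along [z0], where [y ^ 2 = T], the determinant has the root
    [sqrt (8 + T) / 2 - y / 2]. This is affine in [y] and gives the centre and radius used in size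
    3; in the other directions the factor [T - y ^ 2] decides the sign. *)
Lemma pencil3_nonpos (T y : R) :
  y ^ 2 <= T -> T < 1 -> pencil3 T y (sqrt (8 + T) / 2 - y / 2) <= 0.
Proof.
  intros Hy HT.
  assert (HT0 : 0 <= T) by (pose proof (pow2_ge_0 y); lra).
  pose proof (sqrt_pos (8 + T)) as Hs0.
  assert (Hs : sqrt (8 + T) * sqrt (8 + T) = 8 + T) by (apply sqrt_sqrt; lra).
  set (s := sqrt (8 + T)) in *.
  replace (pencil3 T y (s / 2 - y / 2)) with (- ((T - y ^ 2) * (3 * s - y) / 8)).
  2: { unfold pencil3, chain2, chain_off, chain_diag.
       replace T with (s * s - 8) by lra. field. }
  assert (y <= 1) by nra.
  assert (2 <= s) by nra.
  assert (0 <= (T - y ^ 2) * (3 * s - y)) by (apply Rmult_le_pos; lra).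
  lra.
Qed.

Lemma sqrt5_bounds : 2.236 < sqrt 5 < 2.2361.
Proof.
  split.
  - rewrite <- (sqrt_square 2.236) by lra. apply sqrt_lt_1; lra.
  - rewrite <- (sqrt_square 2.2361) by lra. apply sqrt_lt_1; lra.
Qed.

(** At [T = y = 0] the determinant is [mu^4 - 3 mu^2 + 1], with largest root
    [(1 + sqrt 5) / 2 = 2 cos (PI / 5)]. The slope [2 / sqrt 5] cancels the term linear in [y],
    whence the factor [y ^ 2] in front of [P0]. *)
Lemma pencil4_nonpos (T y : R) :
  y ^ 2 <= T -> T <= 5 / 8 ->
  pencil4 T y ((1 + sqrt 5) / 2 + T / 4 - 2 * sqrt 5 / 5 * y) <= 0.
Proof.
  intros Hy HT.
  pose proof sqrt5_bounds as Hb.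
  assert (Hs : sqrt 5 * sqrt 5 = 5) by (apply sqrt_sqrt; lra).
  set (s := sqrt 5) in *. clearbody s.
  assert (Hy5 : y <= 4 / 5) by nra.
  (* In terms of [q = T - y^2] the determinant is
     [y^2 P0 + q P1 + q^2 P2 + q^3 P3 - 15/256 q^4], and all coefficients of the [Pi]
     as polynomials in [4/5 - y >= 0] are negative. *)
  set (P0 := (-19/20 + 1/20 * s) + (4/5 + 24/25 * s) * y + (-277/200 + -97/80 * s) * y^2 + (9/4 + 33/100 * s) * y^3 + (-27/32 + -7/32 * s) * y^4 + (7/40 * s) * y^5 + -15/256 * y^6).
  set (P1 := (-7/4 + -3/4 * s) + (4 + 8/5 * s) * y + (-73/20 + -81/40 * s) * y^2 + (9/2 + 49/50 * s) * y^3 + (-65/32 + -21/32 * s) * y^4 + (21/40 * s) * y^5 + -15/64 * y^6).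
  set (P2 := (-13/8 + -13/16 * s) + (9/4 + 13/20 * s) * y + (-49/32 + -21/32 * s) * y^2 + (21/40 * s) * y^3 + -45/128 * y^4).
  set (P3 := (-11/32 + -7/32 * s) + (7/40 * s) * y + -15/64 * y^2).
  set (q := T - y ^ 2).
  assert (Hq : 0 <= q) by (unfold q; lra).
  replace (pencil4 T y ((1 + s) / 2 + T / 4 - 2 * s / 5 * y))
    with (y ^ 2 * P0 + q * P1 + q ^ 2 * P2 + q ^ 3 * P3 + q ^ 4 * (-15 / 256)).
  2: { replace T with (q + y ^ 2) by (unfold q; ring).
       unfold pencil4, chain3, chain2, chain_off, chain_diag, P0, P1, P2, P3.
       clearbody q. field [Hs]. }
  set (w := 4 / 5 - y).
  assert (Hw : 0 <= w) by (unfold w; lra).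
  assert (Hpow : forall k, 0 <= w ^ k /\ 0 <= w ^ k * (s - 2.236) /\
                           0 <= w ^ k * (2.2361 - s)).
  { intros k. pose proof (pow_le w k Hw).
    repeat split; auto; apply Rmult_le_pos; lra. }
  destruct (Hpow 1%nat) as (w1 & w1a & w1b). destruct (Hpow 2%nat) as (w2 & w2a & w2b).
  destruct (Hpow 3%nat) as (w3 & w3a & w3b). destruct (Hpow 4%nat) as (w4 & w4a & w4b).
  destruct (Hpow 5%nat) as (w5 & w5a & w5b). destruct (Hpow 6%nat) as (w6 & w6a & w6b).
  assert (Ey : y = 4 / 5 - w) by (unfold w; ring).
  clearbody w q.
  assert (H0 : P0 <= 0) by (unfold P0; rewrite Ey; lra).
  assert (H1 : P1 <= 0) by (unfold P1; rewrite Ey; lra).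
  assert (H2 : P2 <= 0) by (unfold P2; rewrite Ey; lra).
  assert (H3 : P3 <= 0) by (unfold P3; rewrite Ey; lra).
  clearbody P0 P1 P2 P3.
  pose proof (pow2_ge_0 y). pose proof (pow_le q 2 Hq). pose proof (pow_le q 3 Hq).
  pose proof (pow_le q 4 Hq).
  nra.
Qed.

Local Open Scope C_scope.

(** * The compressed shift in coordinates *)

Fixpoint csum (f : nat -> C) (n : nat) : C :=
  match n with O => 0 | S k => csum f k + f k end.

Fixpoint rsum (f : nat -> R) (n : nat) : R :=
  match n with O => 0%R | S k => (rsum f k + f k)%R end.

Lemma csum_ext (f g : nat -> C) (n : nat) :
  (forall k, (k < n)%nat -> f k = g k) -> csum f n = csum g n.
Proof.
  induction n as [|n IH]; simpl; auto. intros H.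
  rewrite IH by (intros; apply H; lia). rewrite H by lia. reflexivity.
Qed.

Lemma csum_plus (f g : nat -> C) (n : nat) :
  csum (fun k => f k + g k) n = csum f n + csum g n.
Proof. induction n as [|n IH]; simpl; [ring|rewrite IH; ring]. Qed.

Lemma csum_scal (c : C) (f : nat -> C) (n : nat) :
  csum (fun k => c * f k) n = c * csum f n.
Proof. induction n as [|n IH]; simpl; [ring|rewrite IH; ring]. Qed.

Lemma csum_conj (f : nat -> C) (n : nat) :
  csum (fun k => Cconj (f k)) n = Cconj (csum f n).
Proof.
  induction n as [|n IH]; simpl; [|rewrite IH, Cplus_conj; reflexivity].
  apply injective_projections; simpl; ring.
Qed.

Lemma csum_zero (n : nat) : csum (fun _ => 0) n = 0.
Proof. induction n as [|n IH]; simpl; [|rewrite IH]; ring. Qed.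

Lemma csum_single (c : C) (j n : nat) :
  (j < n)%nat -> csum (fun k => if Nat.eqb k j then c else 0) n = c.
Proof.
  induction n as [|n IH]; simpl; intros Hj; [lia|].
  destruct (Nat.eqb_spec n j) as [->|Hne].
  - rewrite (csum_ext _ (fun _ => 0)), csum_zero; [ring|].
    intros k Hk. destruct (Nat.eqb_spec k j); [lia|reflexivity].
  - rewrite IH by lia. ring.
Qed.

Lemma csum_exchange (f : nat -> nat -> C) (m n : nat) :
  csum (fun i => csum (f i) n) m = csum (fun j => csum (fun i => f i j) m) n.
Proof.
  induction m as [|m IH]; simpl; [symmetry; apply csum_zero|].
  rewrite IH, <- csum_plus. reflexivity.
Qed.

Lemma rsum_pos (f : nat -> R) (n : nat) :
  (forall k, (k < n)%nat -> 0 <= f k)%R -> (0 <= rsum f n)%R.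
Proof.
  induction n as [|n IH]; simpl; intros H; [lra|].
  specialize (IH (fun k Hk => H k ltac:(lia))). specialize (H n ltac:(lia)). lra.
Qed.

Lemma rsum_term_le (f : nat -> R) (n k : nat) :
  (forall k, 0 <= f k)%R -> (k < n)%nat -> (f k <= rsum f n)%R.
Proof.
  intros H. induction n as [|n IH]; simpl; intros Hk; [lia|].
  pose proof (rsum_pos f n (fun k _ => H k)). pose proof (H n).
  destruct (Nat.eq_dec k n) as [->|]; [lra|]. specialize (IH ltac:(lia)). lra.
Qed.

Lemma Cmod_csum_le (f : nat -> C) (n : nat) :
  (Cmod (csum f n) <= rsum (fun k => Cmod (f k)) n)%R.
Proof.
  induction n as [|n IH]; simpl; [rewrite Cmod_0; lra|].
  pose proof (Cmod_triangle (csum f n) (f n)). lra.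
Qed.

Lemma csum_norm (x : nat -> C) (n : nat) :
  csum (fun k => x k * Cconj (x k)) n = RtoC (rsum (fun k => Cmod (x k) ^ 2)%R n).
Proof.
  induction n as [|n IH]; simpl; auto.
  rewrite IH, RtoC_plus. f_equal. apply injective_projections.
  - pose proof (Cmod_sqr (x n)). simpl in *. lra.
  - simpl. ring.
Qed.

(** The alternating series in [J] summed up: this is [J (1 + conj z0 J)^-1 x], the recursion being
    [(1 + conj z0 J) (lag z0 x) = J x] read entrywise. Entry [k] depends on the entries of [x] below
    [k], whatever the dimension. *)
Fixpoint lag (z0 : C) (x : nat -> C) (k : nat) : C :=
  match k with O => 0 | S j => x j - Cconj z0 * lag z0 x j end.

Definition model_shift (z0 : C) (x : nat -> C) (k : nat) : C :=
  z0 * x k + (1 - z0 * Cconj z0) * lag z0 x k.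

Definition shift_form (z0 : C) (m : nat) (x x' : nat -> C) : C :=
  csum (fun k => model_shift z0 x k * Cconj (x' k)) m.

(** Rayleigh quotients in homogeneous form. The basis functions all have the same norm, so
    normalization can wait until [numerical_range_coef]. *)
Definition coef_range (z0 : C) (m : nat) (w : C) : Prop :=
  exists x : nat -> C,
    (0 < rsum (fun k => Cmod (x k) ^ 2) m)%R /\
    shift_form z0 m x x = w * RtoC (rsum (fun k => Cmod (x k) ^ 2)%R m).

(** * Convexity of the coordinate range *)

Lemma lag_linear (z0 c : C) (p q : nat -> C) (k : nat) :
  lag z0 (fun i => c * p i + q i) k = c * lag z0 p k + lag z0 q k.
Proof. induction k as [|k IH]; simpl; [ring|rewrite IH; ring]. Qed.

Lemma shift_form_expand (z0 c : C) (m : nat) (p q : nat -> C) :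
  shift_form z0 m (fun i => c * p i + q i) (fun i => c * p i + q i) =
  c * Cconj c * shift_form z0 m p p + c * shift_form z0 m p q +
  Cconj c * shift_form z0 m q p + shift_form z0 m q q.
Proof.
  unfold shift_form. rewrite <- !csum_scal, <- !csum_plus. apply csum_ext.
  intros k _. unfold model_shift. rewrite lag_linear, Cplus_conj, Cmult_conj. ring.
Qed.

Lemma norm_expand (c : C) (m : nat) (p q : nat -> C) :
  csum (fun k => (c * p k + q k) * Cconj (c * p k + q k)) m =
  c * Cconj c * csum (fun k => p k * Cconj (p k)) m + c * csum (fun k => p k * Cconj (q k)) m +
  Cconj c * csum (fun k => q k * Cconj (p k)) m + csum (fun k => q k * Cconj (q k)) m.
Proof.
  rewrite <- !csum_scal, <- !csum_plus. apply csum_ext.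
  intros k _. rewrite Cplus_conj, Cmult_conj. ring.
Qed.

(** The two roots have product [- c / a < 0], so there is one for each sign of [g]. *)
Lemma quadratic_root_signed (a b c g : R) :
  (0 < a -> 0 < c -> exists r, r ^ 2 * a + r * b - c = 0 /\ 0 <= r * g)%R.
Proof.
  intros Ha Hc.
  assert (Hpos : (0 < b ^ 2 + 4 * a * c)%R) by nra.
  pose proof (sqrt_pos (b ^ 2 + 4 * a * c)) as HD0.
  pose proof (sqrt_sqrt (b ^ 2 + 4 * a * c) ltac:(lra)) as HD.
  set (D := sqrt (b ^ 2 + 4 * a * c)) in *. clearbody D.
  assert (Hc' : c = ((D * D - b ^ 2) / (4 * a))%R) by (rewrite HD; field; lra).
  assert (Hb : (- D <= b <= D)%R) by nra.
  destruct (Rle_or_lt 0 g) as [Hg|Hg].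
  - exists ((- b + D) / (2 * a))%R. split; [rewrite Hc'; field; lra|].
    apply Rmult_le_pos; auto. apply Rle_div_r; lra.
  - exists ((- b - D) / (2 * a))%R. split; [rewrite Hc'; field; lra|].
    assert ((- b - D) / (2 * a) <= 0)%R by (apply Rle_div_l; lra). nra.
Qed.

(** The imaginary part is a real-linear functional of [om] on the plane, with coefficients [a] and
    [b] below, so it has a nonzero kernel vector. *)
Lemma phase_real (c1 c2 : C) :
  exists om : C, om <> 0 /\ snd (om * c1 + Cconj om * c2) = 0%R.
Proof.
  set (a := (snd c1 + snd c2)%R). set (b := (fst c1 - fst c2)%R).
  destruct (Req_dec (a ^ 2 + b ^ 2) 0) as [H0|H0].
  - exists 1. split; [apply C1_nz|].
    assert (H : (a = 0)%R) by (apply Rsqr_eq_0; unfold Rsqr; nra). unfold a in H. simpl. lra.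
  - exists (b, - a)%R. split.
    + intros H. injection H as Hb Ha. apply H0. nra.
    + simpl. unfold a, b. ring.
Qed.

(* Toeplitz-Hausdorff: on the span of two vectors, a suitable phase makes the equation
   for a convex combination a real quadratic one; the sign of the root is chosen so
   that the solution does not vanish. *)
Lemma coef_range_convex (z0 : C) (m : nat) : convex_C (coef_range z0 m).
Proof.
  intros a b s (p & Hp & Hpa) (q & Hq & Hqb) Hs.
  set (w := ((1 - s) * fst a + s * fst b, (1 - s) * snd a + s * snd b)%R).
  assert (Hw : w = RtoC (1 - s) * a + RtoC s * b).
  { apply injective_projections; simpl; ring. }
  destruct (Req_dec s 0) as [->|Hs0].
  { exists p. split; auto. rewrite Hpa, Hw. f_equal. rewrite Rminus_0_r. ring. }
  destruct (Req_dec s 1) as [->|Hs1].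
  { exists q. split; auto. rewrite Hqb, Hw. f_equal.
    replace (1 - 1)%R with 0%R by ring. ring. }
  destruct (Ceq_dec a b) as [->|Hab].
  { exists p. split; auto. rewrite Hpa, Hw. f_equal. rewrite RtoC_minus. ring. }
  assert (Hab' : a - b <> 0).
  { intros H. apply Hab. replace a with (a - b + b) by ring. rewrite H. ring. }
  set (P := rsum (fun k => Cmod (p k) ^ 2)%R m) in *.
  set (Q := rsum (fun k => Cmod (q k) ^ 2)%R m) in *.
  set (gpq := csum (fun k => p k * Cconj (q k)) m).
  set (gqp := csum (fun k => q k * Cconj (p k)) m).
  assert (Hg : gqp = Cconj gpq).
  { unfold gqp, gpq. rewrite <- csum_conj. apply csum_ext. intros k _.
    rewrite Cmult_conj, Cconj_conj. ring. }
  (* After subtracting [w] times the squared norm and dividing by [a - b], the form takes the real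
     values [s P] at [p] and [- (1 - s) Q] at [q]. The cross terms [c1] and [c2] become real through
     the phase. *)
  set (c1 := (shift_form z0 m p q - w * gpq) / (a - b)).
  set (c2 := (shift_form z0 m q p - w * gqp) / (a - b)).
  destruct (phase_real c1 c2) as (om & Hom & Him).
  set (kap := fst (om * c1 + Cconj om * c2)).
  assert (Hkap : om * c1 + Cconj om * c2 = RtoC kap).
  { apply injective_projections; [reflexivity|exact Him]. }
  assert (Hom2 : om * Cconj om = RtoC (Cmod om ^ 2)).
  { apply injective_projections; [rewrite Cmod_sqr|]; simpl; ring. }
  assert (Hom0 : (0 < Cmod om ^ 2)%R) by (apply pow_lt, Cmod_gt_0, Hom).
  destruct (quadratic_root_signed (s * Cmod om ^ 2 * P) kap ((1 - s) * Q) (fst (om * gpq)))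
    as (r & Hr & Hsign).
  { apply Rmult_lt_0_compat; auto. apply Rmult_lt_0_compat; auto; lra. }
  { apply Rmult_lt_0_compat; auto; lra. }
  set (c := RtoC r * om).
  set (v := fun k => c * p k + q k).
  assert (Hcc : c * Cconj c = RtoC (r ^ 2 * Cmod om ^ 2)).
  { unfold c. rewrite Cmult_conj, RtoC_mult, <- Hom2.
    replace (Cconj (RtoC r)) with (RtoC r) by (apply injective_projections; simpl; ring).
    rewrite RtoC_pow. simpl. ring. }
  assert (HN : csum (fun k => v k * Cconj (v k)) m =
    RtoC (r ^ 2 * Cmod om ^ 2) * RtoC P + c * gpq + Cconj c * gqp + RtoC Q).
  { unfold v. rewrite norm_expand, Hcc, !csum_norm. reflexivity. }
  exists v. rewrite <- csum_norm, HN. split.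
  - rewrite csum_norm in HN. apply (f_equal fst) in HN. rewrite Hg in HN.
    simpl in HN. simpl in Hsign.
    replace (rsum (fun k => Cmod (v k) ^ 2)%R m) with
      (r ^ 2 * Cmod om ^ 2 * P + Q + 2 * (r * (fst om * fst gpq - snd om * snd gpq)))%R
      by (simpl; rewrite HN; ring).
    assert (0 <= r ^ 2 * Cmod om ^ 2 * P)%R.
    { apply Rmult_le_pos; [apply Rmult_le_pos|]; try lra; apply pow2_ge_0. }
    lra.
  - unfold v. rewrite shift_form_expand, Hpa, Hqb, Hcc.
    replace (shift_form z0 m p q) with (c1 * (a - b) + w * gpq)
      by (unfold c1; field; auto).
    replace (shift_form z0 m q p) with (c2 * (a - b) + w * gqp)
      by (unfold c2; field; auto).
    assert (Hc : c * c1 + Cconj c * c2 = RtoC (r * kap)).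
    { rewrite RtoC_mult, <- Hkap. unfold c. rewrite Cmult_conj.
      replace (Cconj (RtoC r)) with (RtoC r) by (apply injective_projections; simpl; ring).
      ring. }
    assert (Hr' : RtoC (r ^ 2 * Cmod om ^ 2) * RtoC s * RtoC P + RtoC (r * kap)
                  - RtoC (1 - s) * RtoC Q = 0).
    { rewrite <- !RtoC_mult, <- RtoC_plus, <- RtoC_minus. f_equal.
      rewrite <- Hr. ring. }
    assert (Hfin : forall X Y Z' U V : C, X = Y + Z' * (a - b) -> Z' = 0 -> X = Y).
    { intros X Y Z' _ _ -> ->. ring. }
    apply (Hfin _ _ _ 0 0) with (2 := Hr'). rewrite <- Hc, Hw, RtoC_minus. ring.
Qed.

(** A crude bound, to serve as the [M] of [disk_in_convex]: since [|z0| < 1], each step of the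
    recursion for [lag] adds at most the norm of [x]. *)
Lemma coef_range_bounded (z0 : C) (m : nat) (w : C) :
  in_disk z0 -> coef_range z0 m w -> (Cmod w <= INR m * INR (S m))%R.
Proof.
  intros Hz (x & Hx & Hxw). unfold in_disk in Hz. pose proof (Cmod_ge_0 z0) as Hz0.
  set (N := rsum (fun k => Cmod (x k) ^ 2)%R m) in *.
  pose proof (sqrt_sqrt N ltac:(lra)) as HX. pose proof (sqrt_pos N) as HX0.
  set (X := sqrt N) in *.
  assert (Hterm : forall k, (k < m)%nat -> (Cmod (x k) <= X)%R).
  { intros k Hk. pose proof (Cmod_ge_0 (x k)).
    pose proof (rsum_term_le (fun k => Cmod (x k) ^ 2)%R m k
      (fun k => pow2_ge_0 _) Hk) as H1. change (Cmod (x k) ^ 2 <= N)%R in H1. nra. }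
  assert (Hlag : forall k, (k <= m)%nat -> (Cmod (lag z0 x k) <= INR k * X)%R).
  { induction k as [|k IH]; intros Hk; simpl lag; [rewrite Cmod_0; simpl; lra|].
    specialize (IH ltac:(lia)). specialize (Hterm k ltac:(lia)). rewrite S_INR.
    unfold Cminus. apply Rle_trans with (1 := Cmod_triangle _ _).
    rewrite Cmod_opp, Cmod_mult, Cmod_conj. pose proof (Cmod_ge_0 (lag z0 x k)). nra. }
  assert (Hd : (Cmod (1 - z0 * Cconj z0) <= 1)%R).
  { replace (1 - z0 * Cconj z0) with (RtoC (1 - Cmod z0 ^ 2)).
    - rewrite Cmod_R. rewrite Rabs_pos_eq; nra.
    - apply injective_projections; [rewrite Cmod_sqr|]; simpl; ring. }
  assert (Hsum : forall j, (j <= m)%nat ->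
    (rsum (fun k => Cmod (model_shift z0 x k * Cconj (x k))) j <= INR j * (INR (S m) * N))%R).
  { induction j as [|j IH]; intros Hj; simpl rsum; [simpl; lra|].
    specialize (IH ltac:(lia)). rewrite (S_INR j).
    assert (Cmod (model_shift z0 x j * Cconj (x j)) <= INR (S m) * N)%R; [|lra].
    rewrite Cmod_mult, Cmod_conj.
    specialize (Hlag j ltac:(lia)). specialize (Hterm j ltac:(lia)).
    assert (Hjm : (INR j <= INR m)%R) by (apply le_INR; lia).
    assert (Cmod (model_shift z0 x j) <= INR (S m) * X)%R.
    { unfold model_shift. apply Rle_trans with (1 := Cmod_triangle _ _).
      rewrite !Cmod_mult, S_INR.
      pose proof (Cmod_ge_0 (x j)). pose proof (Cmod_ge_0 (lag z0 x j)).
      pose proof (Cmod_ge_0 (1 - z0 * Cconj z0)). nra. }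
    rewrite <- HX. rewrite <- Rmult_assoc.
    apply Rmult_le_compat; auto using Cmod_ge_0. }
  pose proof (Cmod_csum_le (fun k => model_shift z0 x k * Cconj (x k)) m) as Hle.
  fold (shift_form z0 m x x) in Hle. rewrite Hxw, Cmod_mult, Cmod_R, Rabs_pos_eq in Hle by lra.
  specialize (Hsum m ltac:(lia)).
  apply Rmult_le_reg_r with N; auto. lra.
Qed.

(* With [x k = u (k+1) + conj z0 * u k] the lagged sequence of [x] is [u] itself,
   which turns the form into a tridiagonal one in [u]. *)
Definition pencil_term (z0 e : C) (mu : R) (u : nat -> C) (k : nat) : R :=
  (mu * Cmod (u (S k)) ^ 2 + (mu * Cmod z0 ^ 2 - 2 * dot e z0) * Cmod (u k) ^ 2
   - 2 * fst ((Cconj e - mu * Cconj z0) * u k * Cconj (u (S k)))%C)%R.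

Lemma dot_csum (e : C) (f : nat -> C) (n : nat) :
  dot e (csum f n) = rsum (fun k => dot e (f k)) n.
Proof.
  induction n as [|n IH]; simpl; [unfold dot; simpl; ring|].
  rewrite <- IH. unfold dot. simpl. ring.
Qed.

(** Summand by summand ([Hid]), the component of the shift form along [e] is the target value times
    the squared norm of [x], minus [(1 - |z0|^2) / 2] times the form in [u]. *)
Lemma coef_range_direction (z0 e : C) (m : nat) (mu : R) (u : nat -> C) :
  in_disk z0 -> u 0%nat = 0 ->
  (exists k, (k <= m)%nat /\ u k <> 0) ->
  (rsum (pencil_term z0 e mu u) m <= 0)%R ->
  exists p : C, coef_range z0 m p /\
    (dot e z0 + (1 - Cmod z0 ^ 2) / 2 * mu <= dot e p)%R.
Proof.
  intros Hz Hu0 Hne Hform.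
  set (x := fun k => u (S k) + Cconj z0 * u k).
  assert (Hlag : forall k, lag z0 x k = u k).
  { induction k as [|k IH]; simpl; auto. rewrite IH. unfold x. ring. }
  set (N := rsum (fun k => Cmod (x k) ^ 2)%R m).
  assert (HN0 : (0 <= N)%R) by (apply rsum_pos; intros; apply pow2_ge_0).
  (* If [x] vanished, [u (k+1) = - conj z0 * u k] and [u 0 = 0] would force [u] to vanish up to
     index [m]. *)
  assert (HN : (0 < N)%R).
  { destruct HN0 as [H|H]; auto. exfalso.
    assert (Hx0 : forall k, (k < m)%nat -> x k = 0).
    { intros k Hk. pose proof (rsum_term_le (fun k => Cmod (x k) ^ 2)%R m k
        (fun k => pow2_ge_0 _) Hk) as H1. change (Cmod (x k) ^ 2 <= N)%R in H1.
      apply Cmod_eq_0. apply Rsqr_eq_0. unfold Rsqr.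
      pose proof (Cmod_ge_0 (x k)). nra. }
    destruct Hne as (k & Hk & Huk). apply Huk. clear Huk.
    induction k as [|k IH]; auto.
    specialize (Hx0 k ltac:(lia)). unfold x in Hx0. rewrite IH in Hx0 by lia.
    rewrite <- Hx0. ring. }
  set (p := shift_form z0 m x x / RtoC N).
  assert (HNC : RtoC N <> 0) by (intros E; apply RtoC_inj in E; lra).
  exists p. split.
  { exists x. split; auto. fold N. unfold p. field. auto. }
  assert (Hp : (dot e (shift_form z0 m x x) = N * dot e p)%R).
  { replace (shift_form z0 m x x) with (RtoC N * p) by (unfold p; field; auto).
    unfold dot; simpl; ring. }
  assert (Hid : forall j, (rsum (fun k => dot e (model_shift z0 x k * Cconj (x k))) j =
     (dot e z0 + (1 - Cmod z0 ^ 2) / 2 * mu) * rsum (fun k => Cmod (x k) ^ 2) j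
     - (1 - Cmod z0 ^ 2) / 2 * rsum (pencil_term z0 e mu u) j)%R).
  { induction j as [|j IH]; cbn [rsum]; [ring|]. rewrite IH.
    unfold model_shift, pencil_term. rewrite Hlag, !Cmod_sqr. unfold x, dot.
    simpl. field. }
  unfold shift_form in Hp. rewrite dot_csum, Hid in Hp. fold N in Hp.
  unfold in_disk in Hz. pose proof (Cmod_ge_0 z0).
  apply Rmult_le_reg_l with N; auto. rewrite <- Hp.
  assert (0 <= (1 - Cmod z0 ^ 2) / 2)%R by nra. nra.
Qed.

Definition attains (z0 e : C) (mu : R) (m : nat) : Prop :=
  exists p : C, coef_range z0 m p /\
    (dot e z0 + (1 - Cmod z0 ^ 2) / 2 * mu <= dot e p)%R.

(** An inner diagonal entry collects [mu] from one summand and [mu T - 2 y] from the next; the last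
    entry has no next summand and keeps [mu]. *)
Lemma pencil_sum (z0 e a1 a2 a3 a4 : C) (mu : R) (u : nat -> C := fun k => match k return C with
    | 1%nat => a1 | 2%nat => a2 | 3%nat => a3 | 4%nat => a4 | _ => 0 end)
    (A := chain_diag (Cmod z0 ^ 2) (dot e z0) mu)
    (cross : C -> C -> R := fun p q => fst ((Cconj e - mu * Cconj z0) * p * Cconj q)) :
  rsum (pencil_term z0 e mu u) 3 =
    (A * Cmod a1 ^ 2 + A * Cmod a2 ^ 2 + mu * Cmod a3 ^ 2
     - 2 * cross a1 a2 - 2 * cross a2 a3)%R /\
  rsum (pencil_term z0 e mu u) 4 =
    (A * Cmod a1 ^ 2 + A * Cmod a2 ^ 2 + A * Cmod a3 ^ 2 + mu * Cmod a4 ^ 2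
     - 2 * cross a1 a2 - 2 * cross a2 a3 - 2 * cross a3 a4)%R.
Proof.
  unfold pencil_term, cross, A, chain_diag, u; cbn [rsum].
  rewrite Cmod_0. split; simpl; ring.
Qed.

Lemma chain_off_sqr (z0 e : C) (mu : R) : dot e e = 1%R ->
  chain_off (Cmod z0 ^ 2) (dot e z0) mu = (Cmod (e - mu * z0) ^ 2)%R.
Proof.
  intros He. unfold chain_off. rewrite !Cmod_sqr.
  replace 1%R with (dot e e). unfold dot; simpl; ring.
Qed.

Lemma RtoC_neq0 (r : R) : r <> 0%R -> RtoC r <> 0.
Proof. intros H E. apply H, RtoC_inj, E. Qed.

(* The test vectors are the last columns of the adjugates of the leading principal
   blocks: such a column gives the value (block minor) * (previous minor). *)
Lemma attains_of_pencil (z0 e : C) (mu : R)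
    (T := (Cmod z0 ^ 2)%R) (y := dot e z0) :
  in_disk z0 -> dot e e = 1%R ->
  ((pencil3 T y mu <= 0)%R -> attains z0 e mu 3) /\
  ((pencil4 T y mu <= 0)%R -> attains z0 e mu 4).
Proof.
  intros Hz He.
  set (A := chain_diag T y mu). set (B := chain_off T y mu).
  set (E2 := chain2 T y mu). set (E3 := chain3 T y mu).
  set (c := e - mu * z0).
  assert (HB : B = (fst c ^ 2 + snd c ^ 2)%R).
  { unfold B, T, y. rewrite chain_off_sqr by auto. apply Cmod_sqr. }
  assert (HE2 : E2 = (A * A - B)%R) by (unfold E2, chain2, A, B; ring).
  assert (HE3 : E3 = (A * E2 - B * A)%R) by reflexivity.
  assert (Hc : Cconj e - mu * Cconj z0 = Cconj c).
  { unfold c. apply injective_projections; simpl; ring. }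
  assert (Hgen : forall a1 a2 a3 : C, (a1 <> 0 \/ a2 <> 0 \/ a3 <> 0) ->
    ((A * Cmod a1 ^ 2 + A * Cmod a2 ^ 2 + mu * Cmod a3 ^ 2
     - 2 * fst (Cconj c * a1 * Cconj a2)%C - 2 * fst (Cconj c * a2 * Cconj a3)%C <= 0)%R ->
     attains z0 e mu 3)).
  { intros a1 a2 a3 Hne Hle.
    destruct (pencil_sum z0 e a1 a2 a3 0 mu) as [Hs _].
    eapply coef_range_direction; [auto| |  |rewrite Hs, Hc; exact Hle]; [reflexivity|].
    destruct Hne as [H|[H|H]]; [exists 1%nat|exists 2%nat|exists 3%nat]; auto. }
  assert (Hgen4 : forall a1 a2 a3 a4 : C, (a1 <> 0 \/ a2 <> 0 \/ a3 <> 0 \/ a4 <> 0) ->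
    ((A * Cmod a1 ^ 2 + A * Cmod a2 ^ 2 + A * Cmod a3 ^ 2 + mu * Cmod a4 ^ 2
     - 2 * fst (Cconj c * a1 * Cconj a2)%C - 2 * fst (Cconj c * a2 * Cconj a3)%C
     - 2 * fst (Cconj c * a3 * Cconj a4)%C <= 0)%R ->
     attains z0 e mu 4)).
  { intros a1 a2 a3 a4 Hne Hle.
    destruct (pencil_sum z0 e a1 a2 a3 a4 mu) as [_ Hs].
    eapply coef_range_direction; [auto| |  |rewrite Hs, Hc; exact Hle]; [reflexivity|].
    destruct Hne as [H|[H|[H|H]]];
      [exists 1%nat|exists 2%nat|exists 3%nat|exists 4%nat]; auto. }
  assert (HP3 : pencil3 T y mu = (mu * E2 - B * A)%R) by reflexivity.
  assert (HP4 : pencil4 T y mu = (mu * E3 - B * E2)%R) by reflexivity.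
  clearbody A B E2 E3 c. destruct c as [c1 c2]. simpl fst in HB; simpl snd in HB.
  split; intros HP; [rewrite HP3 in HP|rewrite HP4 in HP].
  (* Sylvester's criterion made explicit: the first nonpositive leading minor selects the block, and
     the last nonzero entry of the test vector is the preceding minor, positive by choice. *)
  - destruct (Rle_or_lt A 0) as [HA|HA]; [|destruct (Rle_or_lt E2 0) as [H2|H2]].
    + apply (Hgen 1 0 0); [left; apply C1_nz|].
      rewrite !Cmod_sqr. simpl. lra.
    + apply (Hgen (c1, c2) A 0); [right; left; apply RtoC_neq0; lra|].
      rewrite !Cmod_sqr. simpl. rewrite HE2 in H2.
      assert (A * (A * A - B) <= 0)%R by nra. subst B. lra.
    + apply (Hgen ((c1, c2) * (c1, c2)) (A * (c1, c2)) E2).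
      { right; right; apply RtoC_neq0; lra. }
      assert (E2 * (mu * E2 - B * A) <= 0)%R by nra.
      rewrite !Cmod_sqr. simpl. subst E2 B. lra.
  - destruct (Rle_or_lt A 0) as [HA|HA]; [|destruct (Rle_or_lt E2 0) as [H2|H2];
      [|destruct (Rle_or_lt E3 0) as [H3|H3]]].
    + apply (Hgen4 1 0 0 0); [left; apply C1_nz|].
      rewrite !Cmod_sqr. simpl. lra.
    + apply (Hgen4 (c1, c2) A 0 0); [right; left; apply RtoC_neq0; lra|].
      rewrite !Cmod_sqr. simpl. rewrite HE2 in H2.
      assert (A * (A * A - B) <= 0)%R by nra. subst B. lra.
    + apply (Hgen4 ((c1, c2) * (c1, c2)) (A * (c1, c2)) E2 0).
      { right; right; left; apply RtoC_neq0; lra. }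
      assert (E2 * (A * E2 - B * A) <= 0)%R by nra.
      rewrite !Cmod_sqr. simpl. subst E2 B. lra.
    + apply (Hgen4 ((c1, c2) * (c1, c2) * (c1, c2)) (A * ((c1, c2) * (c1, c2)))
                   (E2 * (c1, c2)) E3).
      { right; right; right; apply RtoC_neq0; lra. }
      assert (E3 * (mu * E3 - B * E2) <= 0)%R by nra.
      rewrite !Cmod_sqr. simpl. subst E3 E2 B. lra.
Qed.

Local Open Scope R_scope.

(** * Pseudohyperbolic disks in the coordinate range *)

(* The Euclidean disk used has centre [(1 - (1 - T) g) z0] and radius [(1 - T) rho]. *)
Lemma coef_range_contains (z0 : C) (m : nat) (g rho r : R)
    (T := Cmod z0 ^ 2) :
  in_disk z0 -> 0 < r < 1 -> 0 <= g <= 1 -> 0 < rho -> (1 - T) * rho < 1 ->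
  r * (1 + 2 * T * g - T * (1 - T) * g ^ 2 + (1 - T) * rho ^ 2) <= rho * (1 + r ^ 2) ->
  (forall e : C, dot e e = 1 -> dot e z0 ^ 2 <= T ->
     attains z0 e (2 * rho - 2 * g * dot e z0) m) ->
  contains_pseudohyperbolic_disk (coef_range z0 m) r.
Proof.
  intros Hz Hr Hg Hrho Hrho1 Hle Hdir. split; auto.
  assert (HT : 0 <= T < 1).
  { unfold T, in_disk in *. pose proof (Cmod_ge_0 z0). nra. }
  set (Z := (RtoC (1 - (1 - T) * g) * z0)%C).
  assert (HZ : Cmod Z = (1 - (1 - T) * g) * Cmod z0).
  { unfold Z. rewrite Cmod_mult, Cmod_R, Rabs_pos_eq; [reflexivity|nra]. }
  destruct (pseudohyperbolic_disk_in_disk Z ((1 - T) * rho) r) as (w0 & Hw0 & Hin); auto.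
  - nra.
  - rewrite HZ. unfold in_disk in Hz. pose proof (Cmod_ge_0 z0).
    assert (0 <= (1 - T) * g) by (apply Rmult_le_pos; lra). nra.
  - rewrite HZ.
    replace (((1 - (1 - T) * g) * Cmod z0) ^ 2) with ((1 - (1 - T) * g) ^ 2 * T)
      by (unfold T; ring).
    replace (r * (1 - (1 - (1 - T) * g) ^ 2 * T + ((1 - T) * rho) ^ 2)) with
      ((1 - T) * (r * (1 + 2 * T * g - T * (1 - T) * g ^ 2 + (1 - T) * rho ^ 2))) by ring.
    rewrite (Rmult_assoc (1 - T)). apply Rmult_le_compat_l; lra.
  - exists w0. split; auto. intros z Hzin.
    apply (disk_in_convex (coef_range z0 m) Z ((1 - T) * rho) (INR m * INR (S m)));
      auto using coef_range_convex.
    { intros p Hp. apply coef_range_bounded with z0; auto. }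
    (* With [y = dot e z0], the disk has support [y + (1 - T) / 2 * (2 rho - 2 g y)] in direction
       [e], which is the bound in [attains]. *)
    intros e He. destruct (Hdir e He) as (p & Hp & Hpe).
    { pose proof (Cmod_dot_le e z0 He) as H. rewrite <- pow2_abs. unfold T.
      pose proof (Rabs_pos (dot e z0)). pose proof (Cmod_ge_0 z0). nra. }
    exists p. split; auto. refine (Rle_trans _ _ _ (Req_le _ _ _) Hpe).
    unfold Z, dot, T. simpl. field.
Qed.

Lemma coef_range3_contains (z0 : C) (r : R) :
  in_disk z0 -> 0 < r < 1 -> 6 * r <= sqrt (8 + Cmod z0 ^ 2) * (1 + r ^ 2) ->
  contains_pseudohyperbolic_disk (coef_range z0 3) r.
Proof.
  intros Hz Hr Hle.
  assert (HT : 0 <= Cmod z0 ^ 2 < 1).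
  { unfold in_disk in *. pose proof (Cmod_ge_0 z0). nra. }
  pose proof (sqrt_pos (8 + Cmod z0 ^ 2)).
  pose proof (sqrt_sqrt (8 + Cmod z0 ^ 2) ltac:(lra)) as Hs.
  apply coef_range_contains with (1 / 4) (sqrt (8 + Cmod z0 ^ 2) / 4); auto; try lra.
  - assert (0 < sqrt (8 + Cmod z0 ^ 2)) by (apply sqrt_lt_R0; lra). lra.
  - assert (sqrt (8 + Cmod z0 ^ 2) <= 3) by nra. nra.
  - set (s := sqrt (8 + Cmod z0 ^ 2)) in *. set (T := Cmod z0 ^ 2) in *.
    (* All terms in [T] cancel, which leaves the hypothesis [6 r <= s (1 + r^2)]. *)
    replace (1 + 2 * T * (1 / 4) - T * (1 - T) * (1 / 4) ^ 2 + (1 - T) * (s / 4) ^ 2)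
      with (3 / 2) by (clearbody s; replace (s / 4) with (/ 4 * s) by field; field [Hs]).
    lra.
  - intros e He Hy. apply attains_of_pencil; auto.
    replace (2 * (sqrt (8 + Cmod z0 ^ 2) / 4) - 2 * (1 / 4) * dot e z0)
      with (sqrt (8 + Cmod z0 ^ 2) / 2 - dot e z0 / 2) by field.
    apply pencil3_nonpos; lra.
Qed.

Lemma coef_range4_contains (z0 : C) :
  in_disk z0 -> Cmod z0 ^ 2 <= 5 / 8 ->
  contains_pseudohyperbolic_disk (coef_range z0 4) ((1 + sqrt 5) / 4).
Proof.
  intros Hz HT8.
  assert (HT : 0 <= Cmod z0 ^ 2 < 1).
  { unfold in_disk in *. pose proof (Cmod_ge_0 z0). nra. }
  pose proof sqrt5_bounds as Hb. pose proof (sqrt_sqrt 5 ltac:(lra)) as Hs.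
  (* The value [1 / sqrt 5] is forced by first-order perturbation at [z0 = 0]. *)
  apply coef_range_contains with (sqrt 5 / 5) ((1 + sqrt 5) / 4 + Cmod z0 ^ 2 / 8);
    auto; try lra.
  - nra.
  - set (s := sqrt 5) in *. set (T := Cmod z0 ^ 2) in *. clearbody s T.
    apply Rminus_le_0.
    (* The slack vanishes at [T = 0]; the term [T / 8] in the radius makes its first-order
       coefficient positive, as [19 sqrt 5 > 39]. *)
    replace (_ - _) with (T * ((-39 + 19 * s) / 320 + (51 - 29 * s) / 1280 * T
                               + (1 + s) / 256 * T ^ 2)) by field [Hs].
    apply Rmult_le_pos; nra.
  - intros e He Hy. apply attains_of_pencil; auto.
    replace (2 * ((1 + sqrt 5) / 4 + Cmod z0 ^ 2 / 8) - 2 * (sqrt 5 / 5) * dot e z0)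
      with ((1 + sqrt 5) / 2 + Cmod z0 ^ 2 / 4 - 2 * sqrt 5 / 5 * dot e z0) by field.
    apply pencil4_nonpos; lra.
Qed.

(** Equality occurs for [T] near 0.608, so the threshold [5 / 8] leaves a margin for decimal
    bounds. *)
Lemma golden_radius (T : R) : 5 / 8 <= T ->
  6 * ((1 + sqrt 5) / 4) <= sqrt (8 + T) * (1 + ((1 + sqrt 5) / 4) ^ 2).
Proof.
  intros HT. pose proof sqrt5_bounds as Hb. pose proof (sqrt_sqrt 5 ltac:(lra)) as Hs.
  assert (H : 2.9368 <= sqrt (8 + T)).
  { rewrite <- (sqrt_square 2.9368) by lra. apply sqrt_le_1_alt. lra. }
  replace (((1 + sqrt 5) / 4) ^ 2) with ((3 + sqrt 5) / 8) by (field [Hs]).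
  nra.
Qed.

Local Open Scope C_scope.

(** * Hardy space *)

Definition clim (u : nat -> C) (l : C) : Prop :=
  is_lim_seq (fun n => Cmod (u n - l)) 0%R.

Lemma is_lim_seq_0_le (u v : nat -> R) :
  (forall n, 0 <= u n <= v n)%R -> is_lim_seq v 0%R -> is_lim_seq u 0%R.
Proof.
  intros H Hv. apply is_lim_seq_le_le with (fun _ => 0%R) v; auto. apply is_lim_seq_const.
Qed.

Lemma clim_ext (u v : nat -> C) (l : C) : (forall n, u n = v n) -> clim u l -> clim v l.
Proof. intros H. apply is_lim_seq_ext. intros n. rewrite H. reflexivity. Qed.

Lemma clim_const (c : C) : clim (fun _ => c) c.
Proof.
  apply is_lim_seq_ext with (fun _ => 0%R); [|apply is_lim_seq_const].
  intros _. replace (c - c) with (RtoC 0) by ring. symmetry; apply Cmod_0.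
Qed.

Lemma clim_plus (u v : nat -> C) (k l : C) :
  clim u k -> clim v l -> clim (fun n => u n + v n) (k + l).
Proof.
  intros Hu Hv. apply is_lim_seq_0_le with (fun n => Cmod (u n - k) + Cmod (v n - l))%R.
  - intros n. split; [apply Cmod_ge_0|].
    replace (u n + v n - (k + l)) with ((u n - k) + (v n - l)) by ring. apply Cmod_triangle.
  - replace (Finite 0%R) with (Finite (0 + 0)%R) by (f_equal; ring).
    apply is_lim_seq_plus'; auto.
Qed.

Lemma clim_scal (c : C) (u : nat -> C) (l : C) :
  clim u l -> clim (fun n => c * u n) (c * l).
Proof.
  intros Hu. apply is_lim_seq_ext with (fun n => Cmod c * Cmod (u n - l))%R.
  - intros n. rewrite <- Cmod_mult. f_equal. ring.
  - replace (Finite 0%R) with (Rbar_mult (Cmod c) 0%R) by (simpl; f_equal; ring).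
    apply is_lim_seq_scal_l; auto.
Qed.

Lemma clim_conj (u : nat -> C) (l : C) :
  clim u l -> clim (fun n => Cconj (u n)) (Cconj l).
Proof.
  apply is_lim_seq_ext. intros n. rewrite <- Cmod_conj. f_equal.
  rewrite Cminus_conj. reflexivity.
Qed.

Lemma clim_incr (u : nat -> C) (l : C) : clim (fun n => u (S n)) l <-> clim u l.
Proof.
  unfold clim. split; intros H.
  - apply is_lim_seq_incr_1. exact H.
  - apply is_lim_seq_incr_1 in H. exact H.
Qed.

Lemma clim_zero_le (u : nat -> C) (v : nat -> R) :
  (forall n, Cmod (u n) <= v n)%R -> is_lim_seq v 0%R -> clim u 0.
Proof.
  intros H Hv. apply is_lim_seq_0_le with v; auto. intros n.
  replace (u n - 0) with (u n) by ring. split; [apply Cmod_ge_0|auto].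
Qed.

Lemma is_series_clim (a : nat -> C) (l : C) :
  is_series (K := C_AbsRing) (V := C_NormedModule) a l <-> clim (csum a) l.
Proof.
  assert (Hs : forall n, sum_n (G := C_NormedModule) a n = csum a (S n)).
  { induction n as [|n IH].
    - rewrite sum_O. simpl. symmetry; apply Cplus_0_l.
    - rewrite sum_Sn, IH. reflexivity. }
  rewrite <- clim_incr. unfold is_series.
  rewrite (filterlim_locally_ball_norm (K := C_AbsRing) (U := C_NormedModule)).
  unfold clim. rewrite <- is_lim_seq_spec. unfold is_lim_seq', ball_norm.
  split; intros H eps; generalize (H eps); apply filter_imp; intros n Hn.
  - rewrite Hs in Hn. change (Cmod (csum a (S n) - l) < eps)%R in Hn.
    rewrite Rminus_0_r, Rabs_pos_eq by apply Cmod_ge_0. exact Hn.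
  - rewrite Hs. change (Cmod (csum a (S n) - l) < eps)%R.
    rewrite Rminus_0_r, Rabs_pos_eq in Hn by apply Cmod_ge_0. exact Hn.
Qed.

Lemma is_taylor_clim (f : C -> C) (a : nat -> C) :
  is_taylor f a <-> forall z, in_disk z -> clim (csum (fun k => z ^ k * a k)) (f z).
Proof.
  assert (Hp : forall (z : C) k, pow_n (K := C_AbsRing) z k = z ^ k).
  { induction k as [|k IH]; [reflexivity|]. simpl. rewrite IH. reflexivity. }
  assert (He : forall z n, csum (fun k => scal (V := C_NormedModule) (pow_n (K := C_AbsRing) z k) (a k)) n
     = csum (fun k => z ^ k * a k) n).
  { intros z n. apply csum_ext. intros k _. rewrite Hp. reflexivity. }
  unfold is_taylor, is_pseries. split; intros H z Hz; specialize (H z Hz).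
  - apply is_series_clim in H. apply clim_ext with (2 := H). auto.
  - apply is_series_clim. apply clim_ext with (2 := H). auto.
Qed.

Definition pairing (a b : nat -> C) (l : C) : Prop :=
  clim (csum (fun k => a k * Cconj (b k))) l.

(** Square summability as convergence of a self-pairing: whatever preserves pairings, such as a
    Blaschke factor, then preserves membership in the Hardy space. *)
Lemma square_summable_pairing (a : nat -> C) :
  square_summable a <-> exists l, pairing a a l.
Proof.
  assert (Hs : forall n, sum_n (fun k => Cmod (a k) ^ 2)%R n = rsum (fun k => Cmod (a k) ^ 2)%R (S n)).
  { induction n as [|n IH].
    - rewrite sum_O. symmetry. apply Rplus_0_l.
    - rewrite sum_Sn, IH. reflexivity. }
  split.
  - intros (l & Hl). exists (RtoC l). apply clim_incr.
    assert (Hlim : is_lim_seq (sum_n (fun k => Cmod (a k) ^ 2)%R) l) by exact Hl.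
    unfold clim. apply is_lim_seq_ext with
      (fun n => Rabs (sum_n (fun k => Cmod (a k) ^ 2)%R n - l)).
    + intros n. rewrite csum_norm, Hs, <- RtoC_minus, Cmod_R. reflexivity.
    + apply is_lim_seq_abs_0 with (u := fun n => (sum_n (fun k => Cmod (a k) ^ 2)%R n - l)%R).
      replace (Finite 0%R) with (Finite (l - l)%R) by (f_equal; ring).
      apply is_lim_seq_minus'; [auto|apply is_lim_seq_const].
  - intros (l & Hl). exists (fst l).
    change (is_lim_seq (sum_n (fun k => Cmod (a k) ^ 2)%R) (fst l)).
    apply clim_incr in Hl. unfold clim in Hl.
    apply is_lim_seq_ext with (fun n => fst l + (rsum (fun k => Cmod (a k) ^ 2)%R (S n) - fst l))%R.
    { intros n. rewrite Hs. ring. }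
    replace (Finite (fst l)) with (Finite (fst l + 0)%R) by (f_equal; ring).
    apply is_lim_seq_plus'; [apply is_lim_seq_const|].
    apply is_lim_seq_abs_0. apply is_lim_seq_0_le with (2 := Hl).
    intros n. split; [apply Rabs_pos|]. rewrite csum_norm.
    set (N := rsum _ _). replace (N - fst l)%R with (fst (RtoC N - l)) by (simpl; ring).
    apply re_le_Cmod.
Qed.

Lemma pairing_sym (a b : nat -> C) (l : C) : pairing a b l -> pairing b a (Cconj l).
Proof.
  intros H. apply clim_conj in H. apply clim_ext with (2 := H).
  intros n. rewrite <- csum_conj. apply csum_ext. intros k _.
  rewrite Cmult_conj, Cconj_conj. ring.
Qed.

Lemma pairing_scal_l (c : C) (a b : nat -> C) (l : C) :
  pairing a b l -> pairing (fun k => c * a k) b (c * l).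
Proof.
  intros H. apply (clim_scal c) in H. apply clim_ext with (2 := H).
  intros n. rewrite <- csum_scal. apply csum_ext. intros k _. ring.
Qed.

Lemma clim_csum (u : nat -> nat -> C) (l : nat -> C) (n : nat) :
  (forall k, (k < n)%nat -> clim (u k) (l k)) ->
  clim (fun i => csum (fun k => u k i) n) (csum l n).
Proof.
  induction n as [|n IH]; simpl; intros H; [apply clim_const|].
  apply clim_plus; [apply IH; intros; apply H|apply H]; lia.
Qed.

Lemma pairing_csum_l (x : nat -> C) (e : nat -> nat -> C) (b l : nat -> C) (n : nat) :
  (forall k, (k < n)%nat -> pairing (e k) b (l k)) ->
  pairing (fun i => csum (fun k => x k * e k i) n) b (csum (fun k => x k * l k) n).
Proof.
  intros H. apply clim_ext with (fun N =>
    csum (fun k => x k * csum (fun i => e k i * Cconj (b i)) N) n).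
  - intros N. etransitivity.
    + apply csum_ext. intros k _. symmetry. apply csum_scal.
    + rewrite csum_exchange. apply csum_ext. intros i _.
      rewrite Cmult_comm, <- csum_scal. apply csum_ext. intros; ring.
  - apply (clim_csum (fun k N => x k * csum (fun i => e k i * Cconj (b i)) N)).
    intros k Hk. apply clim_scal, H; auto.
Qed.

Lemma is_taylor_csum (x : nat -> C) (f : nat -> C -> C) (e : nat -> nat -> C) (n : nat) :
  (forall k, (k < n)%nat -> is_taylor (f k) (e k)) ->
  is_taylor (fun z => csum (fun k => x k * f k z) n)
            (fun i => csum (fun k => x k * e k i) n).
Proof.
  intros H. apply is_taylor_clim. intros z Hz.
  apply clim_ext with (fun N =>
    csum (fun k => x k * csum (fun i => z ^ i * e k i) N) n).
  - intros N. etransitivity.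
    + apply csum_ext. intros k _. symmetry. apply csum_scal.
    + rewrite csum_exchange. apply csum_ext. intros i _.
      rewrite <- csum_scal. apply csum_ext. intros; ring.
  - apply (clim_csum (fun k N => x k * csum (fun i => z ^ i * e k i) N)
      (fun k => x k * f k z)).
    intros k Hk. apply clim_scal. apply is_taylor_clim; auto.
Qed.

Lemma is_taylor_scal (c : C) (f : C -> C) (a : nat -> C) :
  is_taylor f a -> is_taylor (fun z => c * f z) (fun k => c * a k).
Proof.
  rewrite !is_taylor_clim. intros H z Hz. specialize (H z Hz).
  apply (clim_scal c) in H. apply clim_ext with (2 := H).
  intros n. rewrite <- csum_scal. apply csum_ext. intros k _. ring.
Qed.

Lemma is_taylor_ext (f g : C -> C) (a : nat -> C) :
  (forall z, in_disk z -> f z = g z) -> is_taylor f a -> is_taylor g a.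
Proof. intros H Hf z Hz. rewrite <- H by auto. apply Hf; auto. Qed.

Lemma clim_geom (q : C) : (Cmod q < 1)%R -> clim (csum (fun k => q ^ k)) (/ (1 - q)).
Proof.
  intros Hq.
  assert (Hq1 : 1 - q <> 0).
  { intros H. replace q with (RtoC 1) in Hq; [rewrite Cmod_1 in Hq; lra|].
    replace q with (1 - (1 - q)) by ring. rewrite H. ring. }
  assert (Hs : forall n, csum (fun k => q ^ k) n = / (1 - q) + - / (1 - q) * q ^ n).
  { induction n as [|n IH]; simpl; [field; auto|]. rewrite IH. field; auto. }
  apply clim_ext with (fun n => / (1 - q) + - / (1 - q) * q ^ n); [intros; symmetry; apply Hs|].
  pose proof (clim_plus (fun _ => / (1 - q)) (fun n => - / (1 - q) * q ^ n)
    (/ (1 - q)) (- / (1 - q) * 0)) as H.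
  replace (/ (1 - q) + - / (1 - q) * 0) with (/ (1 - q)) in H by (field; auto).
  apply H; [apply clim_const|]. apply clim_scal.
  apply clim_zero_le with (fun n => Cmod q ^ n)%R.
  - intros n. rewrite Cmod_pow. lra.
  - apply is_lim_seq_geom. rewrite Rabs_pos_eq; auto. apply Cmod_ge_0.
Qed.

(** Once [u] is below [eps (1 - r) / 2], the recursion has fixed point [eps / 2], and the excess of
    [v] over it decays like [r ^ j]. *)
Lemma lagged_lim_0 (u v : nat -> R) (r : R) :
  (0 <= r < 1)%R -> (forall n, 0 <= v n)%R -> (forall n, v (S n) <= u (S n) + r * v n)%R ->
  is_lim_seq u 0%R -> is_lim_seq v 0%R.
Proof.
  intros Hr Hv Hrec Hu. apply is_lim_seq_spec. intros eps.
  apply is_lim_seq_spec in Hu.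
  assert (He : (0 < eps * (1 - r) / 2)%R).
  { pose proof (cond_pos eps). apply Rmult_lt_0_compat; [apply Rmult_lt_0_compat|]; lra. }
  destruct (Hu (mkposreal _ He)) as (N & HN). simpl in HN.
  assert (Hind : forall j, (v (N + j)%nat <= eps / 2 + r ^ j * v N)%R).
  { induction j as [|j IH]; simpl.
    - rewrite Nat.add_0_r. pose proof (cond_pos eps). lra.
    - replace (N + S j)%nat with (S (N + j)) by lia.
      specialize (HN (S (N + j)) ltac:(lia)). apply Rabs_def2 in HN.
      specialize (Hrec (N + j)%nat). nra. }
  assert (Hg : is_lim_seq (fun j => r ^ j * v N)%R 0%R).
  { replace (Finite 0%R) with (Rbar_mult 0%R (v N)) by (simpl; f_equal; ring).
    apply is_lim_seq_scal_r. apply is_lim_seq_geom. rewrite Rabs_pos_eq; lra. }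
  apply is_lim_seq_spec in Hg.
  assert (He2 : (0 < eps / 2)%R) by (pose proof (cond_pos eps); lra).
  destruct (Hg (mkposreal _ He2)) as (J & HJ). simpl in HJ.
  exists (N + J)%nat. intros n Hn.
  replace n with (N + (n - N))%nat by lia.
  specialize (Hind (n - N)%nat). specialize (HJ (n - N)%nat ltac:(lia)).
  apply Rabs_def2 in HJ. pose proof (Hv (N + (n - N))%nat).
  rewrite Rminus_0_r, Rabs_pos_eq by auto. lra.
Qed.

(** * Blaschke factors and the model space *)

(* [geo z0 a] and [blaschke_coef z0 a] are the Taylor coefficients of
   [f / (1 - conj z0 z)] and of [f (z - z0) / (1 - conj z0 z)]. *)
Fixpoint geo (z0 : C) (a : nat -> C) (k : nat) : C :=
  match k with O => a 0%nat | S j => a (S j) + Cconj z0 * geo z0 a j end.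

Definition blaschke_coef (z0 : C) (a : nat -> C) (k : nat) : C :=
  match k with
  | O => - z0 * geo z0 a 0
  | S j => geo z0 a j - z0 * geo z0 a (S j)
  end.

Definition blaschke (z0 z : C) : C := (z - z0) / (1 - Cconj z0 * z).

Lemma blaschke_den_neq0 (z0 z : C) : in_disk z0 -> in_disk z -> 1 - Cconj z0 * z <> 0.
Proof.
  unfold in_disk. intros H0 Hz H.
  assert (Hm : Cconj z0 * z = 1).
  { replace (Cconj z0 * z) with (1 - (1 - Cconj z0 * z)) by ring. rewrite H. ring. }
  apply (f_equal Cmod) in Hm. rewrite Cmod_mult, Cmod_conj, Cmod_1 in Hm.
  pose proof (Cmod_ge_0 z0). pose proof (Cmod_ge_0 z). nra.
Qed.

Lemma geo_lim_0 (z0 : C) (a : nat -> C) :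
  in_disk z0 -> square_summable a -> is_lim_seq (fun k => Cmod (geo z0 a k)) 0%R.
Proof.
  intros Hz Ha. apply ex_series_lim_0 in Ha.
  apply lagged_lim_0 with (fun k => Cmod (a k)) (Cmod z0).
  - split; [apply Cmod_ge_0|exact Hz].
  - intros n. apply Cmod_ge_0.
  - intros n. simpl. apply Rle_trans with (1 := Cmod_triangle _ _).
    rewrite Cmod_mult, Cmod_conj. lra.
  - apply is_lim_seq_ext with (fun k => sqrt (Cmod (a k) ^ 2)).
    + intros n. apply sqrt_pow2, Cmod_ge_0.
    + rewrite <- sqrt_0. apply is_lim_seq_continuous; auto.
      apply continuity_pt_sqrt; lra.
Qed.

(* Multiplication by a Blaschke factor is isometric because the difference of the
   two partial sums telescopes. *)
Lemma blaschke_coef_telescope (z0 : C) (a b : nat -> C) (n : nat) :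
  csum (fun k => blaschke_coef z0 a k * Cconj (blaschke_coef z0 b k)) (S n) =
  csum (fun k => a k * Cconj (b k)) (S n)
  + - (1 - z0 * Cconj z0) * (geo z0 a n * Cconj (geo z0 b n)).
Proof.
  induction n as [|n IH].
  - simpl. rewrite !Cmult_conj, !Copp_conj. ring.
  - change (csum ?f (S (S n))) with (csum f (S n) + f (S n)). rewrite IH.
    simpl geo. unfold blaschke_coef at 1 2. simpl geo.
    rewrite !Cminus_conj, !Cmult_conj, !Cplus_conj, !Cmult_conj, !Cconj_conj.
    simpl. ring.
Qed.

Lemma pairing_blaschke (z0 : C) (a b : nat -> C) (l : C) :
  in_disk z0 -> square_summable a -> square_summable b ->
  pairing a b l -> pairing (blaschke_coef z0 a) (blaschke_coef z0 b) l.
Proof.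
  intros Hz Ha Hb H. apply clim_incr. apply clim_incr in H.
  pose proof (geo_lim_0 z0 a Hz Ha) as H1. pose proof (geo_lim_0 z0 b Hz Hb) as H2.
  assert (H3 : clim (fun n => geo z0 a n * Cconj (geo z0 b n)) 0).
  { apply clim_zero_le with (fun n => Cmod (geo z0 a n) * Cmod (geo z0 b n))%R.
    - intros n. rewrite Cmod_mult, Cmod_conj. lra.
    - replace (Finite 0%R) with (Finite (0 * 0)%R) by (f_equal; ring).
      apply is_lim_seq_mult'; auto. }
  apply (clim_scal (- (1 - z0 * Cconj z0))) in H3.
  pose proof (clim_plus _ _ _ _ H H3) as H4.
  rewrite Cmult_0_r, Cplus_0_r in H4. apply clim_ext with (2 := H4).
  intros n. symmetry. apply blaschke_coef_telescope.
Qed.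

Lemma square_summable_blaschke (z0 : C) (a : nat -> C) :
  in_disk z0 -> square_summable a -> square_summable (blaschke_coef z0 a).
Proof.
  intros Hz Ha. pose proof Ha as Ha'. apply square_summable_pairing in Ha' as (l & Hl).
  apply square_summable_pairing. exists l. apply pairing_blaschke; auto.
Qed.

(** Cleared of the denominator, the partial sums of both sides differ by one boundary term, a
    multiple of [z ^ S n * geo z0 a n], which tends to 0. *)
Lemma is_taylor_blaschke (z0 : C) (f : C -> C) (a : nat -> C) :
  in_disk z0 -> square_summable a -> is_taylor f a ->
  is_taylor (fun z => blaschke z0 z * f z) (blaschke_coef z0 a).
Proof.
  intros H0 Ha. rewrite !is_taylor_clim. intros Hf z Hz. specialize (Hf z Hz).
  pose proof (blaschke_den_neq0 z0 z H0 Hz) as HD.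
  apply clim_incr. apply clim_incr in Hf.
  assert (Hs : forall n,
    (1 - Cconj z0 * z) * csum (fun k => z ^ k * blaschke_coef z0 a k) (S n) =
    (z - z0) * csum (fun k => z ^ k * a k) (S n)
    - (1 - z0 * Cconj z0) * (z ^ S n * geo z0 a n)).
  { induction n as [|n IH]; [simpl; ring|].
    change (csum ?g (S (S n))) with (csum g (S n) + g (S n)).
    rewrite !Cmult_plus_distr_l, IH. unfold blaschke_coef. simpl. ring. }
  assert (H1 : clim (fun n => z ^ S n * geo z0 a n) 0).
  { apply clim_zero_le with (fun n => Cmod (geo z0 a n)); [|apply geo_lim_0; auto].
    intros n. rewrite Cmod_mult, Cmod_pow. unfold in_disk in Hz.
    pose proof (Cmod_ge_0 z). pose proof (Cmod_ge_0 (geo z0 a n)).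
    assert (Cmod z ^ S n <= 1)%R; [|nra].
    rewrite <- (pow1 (S n)). apply pow_incr. lra. }
  apply (clim_scal (- (1 - z0 * Cconj z0) / (1 - Cconj z0 * z))) in H1.
  apply (clim_scal (blaschke z0 z)) in Hf.
  pose proof (clim_plus _ _ _ _ Hf H1) as H4.
  rewrite Cmult_0_r, Cplus_0_r in H4. apply clim_ext with (2 := H4).
  assert (Hsolve : forall X Y g : C,
    (1 - Cconj z0 * z) * X = (z - z0) * Y - (1 - z0 * Cconj z0) * g ->
    blaschke z0 z * Y + - (1 - z0 * Cconj z0) / (1 - Cconj z0 * z) * g = X).
  { intros X Y g H. unfold blaschke.
    replace X with (((1 - Cconj z0 * z) * X) / (1 - Cconj z0 * z)) by (field; auto).
    rewrite H. field; auto. }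
  intros n. apply Hsolve, Hs.
Qed.

Fixpoint blaschke_iter (z0 : C) (n : nat) (a : nat -> C) : nat -> C :=
  match n with O => a | S k => blaschke_coef z0 (blaschke_iter z0 k a) end.

Lemma blaschke_iter_add (z0 : C) (m n : nat) (a : nat -> C) :
  blaschke_iter z0 (m + n) a = blaschke_iter z0 m (blaschke_iter z0 n a).
Proof. induction m as [|m IH]; simpl; [|rewrite IH]; reflexivity. Qed.

Lemma square_summable_iter (z0 : C) (n : nat) (a : nat -> C) :
  in_disk z0 -> square_summable a -> square_summable (blaschke_iter z0 n a).
Proof. induction n; simpl; auto using square_summable_blaschke. Qed.

Lemma pairing_iter (z0 : C) (n : nat) (a b : nat -> C) (l : C) :
  in_disk z0 -> square_summable a -> square_summable b ->
  pairing a b l -> pairing (blaschke_iter z0 n a) (blaschke_iter z0 n b) l.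
Proof.
  intros; induction n; simpl; auto using pairing_blaschke, square_summable_iter.
Qed.

Lemma is_taylor_iter (z0 : C) (n : nat) (f : C -> C) (a : nat -> C) :
  in_disk z0 -> square_summable a -> is_taylor f a ->
  is_taylor (fun z => blaschke z0 z ^ n * f z) (blaschke_iter z0 n a).
Proof.
  intros Hz Ha Hf. induction n as [|n IH]; simpl.
  - apply is_taylor_ext with (2 := Hf). intros; ring.
  - apply (is_taylor_blaschke z0) in IH; auto using square_summable_iter.
    apply is_taylor_ext with (2 := IH). intros; ring.
Qed.

(** Taylor coefficients of the Szegő kernel at [z0]; [pairing_kernel] is its reproducing
    property. *)
Definition kernel_coef (z0 : C) (k : nat) : C := Cconj z0 ^ k.

Lemma Cpow_Cconj (z : C) (k : nat) : Cconj (z ^ k) = Cconj z ^ k.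
Proof.
  induction k as [|k IH]; simpl.
  - apply injective_projections; simpl; ring.
  - rewrite Cmult_conj, IH. reflexivity.
Qed.

Lemma pairing_kernel (z0 : C) (f : C -> C) (a : nat -> C) :
  in_disk z0 -> is_taylor f a -> pairing a (kernel_coef z0) (f z0).
Proof.
  intros Hz Hf. apply is_taylor_clim with (z := z0) in Hf; auto.
  apply clim_ext with (2 := Hf). intros n. apply csum_ext. intros k _.
  unfold kernel_coef. rewrite Cpow_Cconj, Cconj_conj. ring.
Qed.

Lemma is_taylor_kernel (z0 : C) :
  in_disk z0 -> is_taylor (fun z => / (1 - Cconj z0 * z)) (kernel_coef z0).
Proof.
  intros H0. apply is_taylor_clim. intros z Hz.
  assert (Hq : (Cmod (Cconj z0 * z) < 1)%R).
  { rewrite Cmod_mult, Cmod_conj. unfold in_disk in *.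
    pose proof (Cmod_ge_0 z0). pose proof (Cmod_ge_0 z). nra. }
  apply clim_ext with (2 := clim_geom _ Hq). intros n. apply csum_ext. intros k _.
  unfold kernel_coef. rewrite Cpow_mult_l. ring.
Qed.

Lemma square_summable_kernel (z0 : C) : in_disk z0 -> square_summable (kernel_coef z0).
Proof.
  intros Hz. apply square_summable_pairing. eexists.
  apply pairing_kernel, is_taylor_kernel; auto.
Qed.

(** * The orthogonal basis of the model space *)

Definition basis_fun (z0 : C) (k : nat) (z : C) : C :=
  blaschke z0 z ^ k * / (1 - Cconj z0 * z).

Definition basis_coef (z0 : C) (k : nat) : nat -> C :=
  blaschke_iter z0 k (kernel_coef z0).

Lemma is_taylor_basis (z0 : C) (k : nat) :
  in_disk z0 -> is_taylor (basis_fun z0 k) (basis_coef z0 k).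
Proof.
  intros Hz. apply (is_taylor_iter z0 k (fun z => / (1 - Cconj z0 * z)));
    auto using square_summable_kernel, is_taylor_kernel.
Qed.

Lemma blaschke_zero (z0 : C) : blaschke z0 z0 = 0.
Proof. unfold blaschke, Cdiv. replace (z0 - z0) with (RtoC 0) by ring. ring. Qed.

(** By isometry [b^k] cancels from both sides, and the kernel evaluates [b^(n-k) f] at [z0], a zero
    of [b]. With [f] the kernel this gives orthogonality of the basis; with [k < n] it gives
    orthogonality to the multiples of [b^n]. *)
Lemma pairing_iter_basis (z0 : C) (n k : nat) (f : C -> C) (a : nat -> C) :
  in_disk z0 -> (k <= n)%nat -> square_summable a -> is_taylor f a ->
  pairing (blaschke_iter z0 n a) (basis_coef z0 k) (if Nat.eqb n k then f z0 else 0).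
Proof.
  intros Hz Hk Ha Hf. replace n with (k + (n - k))%nat at 1 by lia.
  rewrite blaschke_iter_add. unfold basis_coef.
  apply pairing_iter; auto using square_summable_iter, square_summable_kernel.
  pose proof (pairing_kernel z0 _ _ Hz (is_taylor_iter z0 (n - k) f a Hz Ha Hf)) as H.
  cbv beta in H. rewrite blaschke_zero in H.
  destruct (Nat.eqb_spec n k) as [->|Hne].
  - rewrite Nat.sub_diag in *. simpl in H. rewrite Cmult_1_l in H. exact H.
  - replace (n - k)%nat with (S (n - k - 1)) in H at 2 by lia.
    simpl in H. rewrite !Cmult_0_l in H. exact H.
Qed.

Lemma pairing_basis (z0 : C) (j k : nat) : in_disk z0 ->
  pairing (basis_coef z0 j) (basis_coef z0 k)
    (if Nat.eqb j k then / (1 - z0 * Cconj z0) else 0).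
Proof.
  intros Hz.
  assert (Hle : forall j k, (k <= j)%nat -> pairing (basis_coef z0 j) (basis_coef z0 k)
    (if Nat.eqb j k then / (1 - z0 * Cconj z0) else 0)).
  { intros j' k' H.
    pose proof (pairing_iter_basis z0 j' k' (fun z => / (1 - Cconj z0 * z)) (kernel_coef z0)
      Hz H (square_summable_kernel z0 Hz) (is_taylor_kernel z0 Hz)) as H'.
    cbv beta in H'. rewrite (Cmult_comm z0). exact H'. }
  destruct (Nat.le_gt_cases k j) as [H|H]; auto.
  specialize (Hle k j ltac:(lia)). apply pairing_sym in Hle.
  rewrite Nat.eqb_sym in Hle. destruct (Nat.eqb_spec j k); [lia|].
  replace (Cconj 0) with (RtoC 0) in Hle by (apply injective_projections; simpl; ring).
  exact Hle.
Qed.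

Definition comb_fun (z0 : C) (n : nat) (x : nat -> C) (z : C) : C :=
  csum (fun k => x k * basis_fun z0 k z) n.

Definition comb_coef (z0 : C) (n : nat) (x : nat -> C) (i : nat) : C :=
  csum (fun k => x k * basis_coef z0 k i) n.

Lemma is_taylor_comb (z0 : C) (n : nat) (x : nat -> C) :
  in_disk z0 -> is_taylor (comb_fun z0 n x) (comb_coef z0 n x).
Proof.
  intros Hz. apply (is_taylor_csum x (basis_fun z0)). intros; apply is_taylor_basis; auto.
Qed.

Lemma Cconj_0 : Cconj 0 = 0.
Proof. apply injective_projections; simpl; ring. Qed.

Lemma pairing_comb (z0 : C) (n : nat) (x y : nat -> C) : in_disk z0 ->
  pairing (comb_coef z0 n y) (comb_coef z0 n x)
    (csum (fun k => y k * Cconj (x k)) n / (1 - z0 * Cconj z0)).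
Proof.
  intros Hz.
  assert (Hk : forall k, (k < n)%nat -> pairing (basis_coef z0 k) (comb_coef z0 n x)
     (Cconj (x k * / (1 - z0 * Cconj z0)))).
  { intros k Hk. apply pairing_sym.
    rewrite <- (csum_single (x k * / (1 - z0 * Cconj z0)) k n) by auto.
    erewrite csum_ext; [apply pairing_csum_l|].
    - intros j _. apply pairing_basis; auto.
    - intros j _. cbv beta. destruct (Nat.eqb_spec j k) as [->|]; [reflexivity|ring]. }
  pose proof (pairing_csum_l y _ _ _ n Hk) as H.
  unfold Cdiv. rewrite Cmult_comm, <- csum_scal.
  erewrite csum_ext; [exact H|]. intros k _. cbv beta.
  rewrite Cmult_conj.
  replace (Cconj (/ (1 - z0 * Cconj z0))) with (/ (1 - z0 * Cconj z0)); [ring|].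
  replace (1 - z0 * Cconj z0) with (RtoC (1 - Cmod z0 ^ 2)).
  - rewrite <- RtoC_inv; [apply injective_projections; simpl; ring|].
    unfold in_disk in Hz. pose proof (Cmod_ge_0 z0). nra.
  - apply injective_projections; [rewrite Cmod_sqr|]; simpl; ring.
Qed.

Lemma square_summable_comb (z0 : C) (n : nat) (x : nat -> C) :
  in_disk z0 -> square_summable (comb_coef z0 n x).
Proof. intros Hz. apply square_summable_pairing. eexists. apply pairing_comb; auto. Qed.

Lemma is_inner_pairing (f g : C -> C) (a b : nat -> C) (l : C) :
  is_taylor f a -> square_summable a -> is_taylor g b -> square_summable b ->
  pairing a b l -> is_inner f g l.
Proof.
  intros. exists a, b. repeat split; auto. apply is_series_clim. auto.
Qed.

Lemma is_inner_comb (z0 : C) (n : nat) (x y : nat -> C) : in_disk z0 ->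
  is_inner (comb_fun z0 n y) (comb_fun z0 n x)
    (csum (fun k => y k * Cconj (x k)) n / (1 - z0 * Cconj z0)).
Proof.
  intros Hz. eapply is_inner_pairing;
    eauto using is_taylor_comb, square_summable_comb, pairing_comb.
Qed.

Lemma is_inner_sym (f g : C -> C) (l : C) : is_inner f g l -> is_inner g f (Cconj l).
Proof.
  intros (a & b & [Ha1 Ha2] & [Hb1 Hb2] & H). apply is_series_clim in H.
  eapply is_inner_pairing; eauto. apply pairing_sym. exact H.
Qed.

Lemma model_space_comb (Theta : C -> C) (lambda z0 : C) (n : nat) (x : nat -> C) :
  in_disk z0 ->
  (forall z, in_disk z -> Theta z = lambda * blaschke z0 z ^ n) ->
  model_space Theta (comb_fun z0 n x).
Proof.
  intros Hz HTheta. split.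
  { exists (comb_coef z0 n x). auto using is_taylor_comb, square_summable_comb. }
  intros G (g & (a & Ha & Hsa) & HG).
  set (b := fun k => lambda * blaschke_iter z0 n a k).
  assert (Hb : is_taylor G b).
  { apply is_taylor_ext with (fun z => lambda * (blaschke z0 z ^ n * g z)).
    - intros z Hzd. rewrite HG, HTheta by auto. ring.
    - apply is_taylor_scal. apply is_taylor_iter; auto. }
  assert (Hsb : square_summable b).
  { apply square_summable_pairing. apply square_summable_pairing in Hsa as Hl.
    destruct Hl as (l & Hl). eexists. unfold b. apply pairing_scal_l.
    apply pairing_sym. apply pairing_scal_l. apply pairing_iter; eauto. }
  assert (Hp : pairing (comb_coef z0 n x) b (csum (fun k => x k * 0) n)).
  { apply pairing_csum_l. intros k Hk. rewrite <- Cconj_0.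
    apply pairing_sym. unfold b. rewrite <- (Cmult_0_r lambda). apply pairing_scal_l.
    pose proof (pairing_iter_basis z0 n k g a Hz ltac:(lia) Hsa Ha) as H.
    destruct (Nat.eqb_spec n k); [lia|exact H]. }
  rewrite (csum_ext _ (fun _ => 0)), csum_zero in Hp by (intros; ring).
  eapply is_inner_pairing; eauto using is_taylor_comb, square_summable_comb.
Qed.

(* In the basis [b^k / (1 - conj z0 z)] the part of [z x] beyond degree [n] is
   [b^n] times a constant. *)
Lemma shift_remainder (z0 z : C) (n : nat) (x : nat -> C) :
  1 - Cconj z0 * z <> 0 ->
  z * comb_fun z0 n x z - comb_fun z0 n (model_shift z0 x) z =
  blaschke z0 z ^ n * lag z0 x n.
Proof.
  intros HD. unfold comb_fun. induction n as [|n IH]; simpl; [ring|].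
  transitivity (blaschke z0 z ^ n * lag z0 x n +
    (z * x n - model_shift z0 x n) * basis_fun z0 n z).
  - rewrite <- IH. ring.
  - unfold model_shift, basis_fun, blaschke at 3. simpl.
    set (B := blaschke z0 z ^ n). field. auto.
Qed.

(** * The compressed shift on the basis and its numerical range *)

Lemma H2_const (c : C) : H2 (fun _ => c).
Proof.
  set (a := fun k : nat => if Nat.eqb k 0 then c else 0).
  assert (Hev : forall (u : nat -> C) l, (forall n, u (S n) = l) -> clim u l).
  { intros u l Hu. apply clim_incr. apply clim_ext with (fun _ => l); auto.
    apply clim_const. }
  exists a. split.
  - apply is_taylor_clim. intros z _. apply Hev. intros n.
    rewrite <- (csum_single c 0 (S n)) by lia. apply csum_ext.
    intros [|k] _; unfold a; simpl; ring.
  - apply square_summable_pairing. exists (c * Cconj c). apply Hev. intros n.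
    rewrite <- (csum_single (c * Cconj c) 0 (S n)) by lia. apply csum_ext.
    intros [|k] _; unfold a; simpl; [reflexivity|ring].
Qed.

(** By [shift_remainder] the error of the proposed projection is [Theta] times a constant, to which
    the model space is orthogonal by definition. *)
Lemma compressed_shift_comb (Theta : C -> C) (lambda z0 : C) (n : nat) (x : nat -> C) :
  in_disk z0 -> lambda <> 0 ->
  (forall z, in_disk z -> Theta z = lambda * blaschke z0 z ^ n) ->
  compressed_shift Theta (comb_fun z0 n x) (comb_fun z0 n (model_shift z0 x)).
Proof.
  intros Hz Hl HTheta. split; [|split]; try (eapply model_space_comb; eauto).
  intros g [_ Hg]. rewrite <- Cconj_0. apply is_inner_sym. apply Hg.
  exists (fun _ => lag z0 x n / lambda). split; [apply H2_const|].
  intros z Hzd. unfold mult_z.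
  rewrite shift_remainder, HTheta by auto using blaschke_den_neq0. field. auto.
Qed.

(** Extension by zero: entry [k] of [model_shift] reads entries of [x] up to [k], and from [m] on it
    is multiplied by a zero entry. *)
Lemma coef_range_sub (z0 : C) (m n : nat) (w : C) :
  (m <= n)%nat -> coef_range z0 m w -> coef_range z0 n w.
Proof.
  intros Hmn (x & Hx & Hxw).
  set (x' := fun k => if Nat.ltb k m then x k else 0).
  assert (Hlag : forall k, (k <= m)%nat -> lag z0 x' k = lag z0 x k).
  { induction k as [|k IH]; intros Hk; simpl; auto. rewrite IH by lia.
    unfold x'. destruct (Nat.ltb_spec k m); [reflexivity|lia]. }
  assert (Htr : forall f g : nat -> C, (forall k, (k < m)%nat -> f k = g k) ->
    (forall k, (m <= k)%nat -> f k = 0) -> csum f n = csum g m).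
  { intros f g Hfg Hf0. induction Hmn as [|n Hmn IH].
    - apply csum_ext; auto.
    - simpl. rewrite IH, Hf0 by lia. ring. }
  assert (HN : rsum (fun k => Cmod (x' k) ^ 2)%R n = rsum (fun k => Cmod (x k) ^ 2)%R m).
  { apply RtoC_inj. rewrite <- !csum_norm. apply Htr.
    - intros k Hk. unfold x'. destruct (Nat.ltb_spec k m); [reflexivity|lia].
    - intros k Hk. unfold x'. destruct (Nat.ltb_spec k m); [lia|ring]. }
  exists x'. rewrite HN. split; auto. rewrite <- Hxw. apply Htr.
  - intros k Hk. unfold model_shift. rewrite Hlag by lia.
    unfold x'. destruct (Nat.ltb_spec k m); [reflexivity|lia].
  - intros k Hk. unfold x' at 2. destruct (Nat.ltb_spec k m); [lia|].
    rewrite Cconj_0. ring.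
Qed.

Lemma numerical_range_coef (Theta : C -> C) (lambda z0 : C) (n : nat) (w : C) :
  in_disk z0 -> lambda <> 0 ->
  (forall z, in_disk z -> Theta z = lambda * blaschke z0 z ^ n) ->
  coef_range z0 n w -> numerical_range (compressed_shift Theta) w.
Proof.
  intros Hz Hl HTheta (x & Hx & Hxw).
  set (N := rsum (fun k => Cmod (x k) ^ 2)%R n) in *.
  set (d := (1 - Cmod z0 ^ 2)%R).
  assert (Hd : (0 < d)%R).
  { unfold d, in_disk in *. pose proof (Cmod_ge_0 z0). nra. }
  assert (HdC : 1 - z0 * Cconj z0 = RtoC d).
  { apply injective_projections; unfold d; [rewrite Cmod_sqr|]; simpl; ring. }
  (* The combination with coefficients [x] has squared norm [N / d], so scaling by [t] normalizes
     it. *)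
  set (t := sqrt (d / N)).
  assert (Ht : RtoC t * RtoC t = RtoC d / RtoC N).
  { rewrite <- RtoC_mult, <- RtoC_div by lra. f_equal. apply sqrt_sqrt.
    apply Rlt_le, Rdiv_lt_0_compat; auto. }
  assert (HtC : Cconj (RtoC t) = RtoC t) by (apply injective_projections; simpl; ring).
  assert (HNC : RtoC N <> 0) by (intros E; apply RtoC_inj in E; lra).
  assert (HdC0 : RtoC d <> 0) by (intros E; apply RtoC_inj in E; lra).
  set (x' := fun k => RtoC t * x k).
  assert (Hlag : forall k, lag z0 x' k = RtoC t * lag z0 x k).
  { induction k as [|k IH]; simpl; [ring|]. rewrite IH. unfold x'. ring. }
  exists (comb_fun z0 n x'), (comb_fun z0 n (model_shift z0 x')).
  split; [|split].
  - apply compressed_shift_comb with lambda; auto.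
  - pose proof (is_inner_comb z0 n x' x' Hz) as H.
    replace (csum _ n / _) with (RtoC 1) in H; [exact H|].
    rewrite HdC, (csum_ext _ (fun k => RtoC t * RtoC t * (x k * Cconj (x k)))).
    + rewrite csum_scal, csum_norm, Ht. fold N. field. auto.
    + intros k _. unfold x'. rewrite Cmult_conj, HtC. ring.
  - pose proof (is_inner_comb z0 n x' (model_shift z0 x') Hz) as H.
    replace (csum _ n / _) with w in H; [exact H|].
    rewrite HdC, (csum_ext _
      (fun k => RtoC t * RtoC t * (model_shift z0 x k * Cconj (x k)))).
    + rewrite csum_scal. fold (shift_form z0 n x x). rewrite Hxw, Ht. field. auto.
    + intros k _. unfold model_shift. rewrite Hlag. unfold x'.
      rewrite Cmult_conj, HtC. ring.
Qed.

Local Open Scope R_scope.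

Lemma cos_PI5 : cos (PI / 5) = 1 / 4 * (1 + sqrt 5).
Proof.
  set (c := cos (PI / 5)).
  assert (Hc : 0 < c).
  { apply cos_gt_0; pose proof PI_RGT_0; lra. }
  (* [cos (3 PI / 5) = - cos (2 PI / 5)], expanded in [c] *)
  assert (E2 : cos (2 * (PI / 5)) = 2 * c * c - 1) by apply cos_2a_cos.
  assert (E3 : cos (3 * (PI / 5)) = 4 * c * c * c - 3 * c).
  { replace (3 * (PI / 5)) with (2 * (PI / 5) + PI / 5) by ring.
    rewrite cos_plus, E2, sin_2a. fold c.
    pose proof (sin2_cos2 (PI / 5)) as H. unfold Rsqr in H. fold c in H.
    replace (2 * sin (PI / 5) * c * sin (PI / 5)) with
      (2 * c * (sin (PI / 5) * sin (PI / 5))) by ring.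
    replace (sin (PI / 5) * sin (PI / 5)) with (1 - c * c) by lra. ring. }
  assert (E : cos (3 * (PI / 5)) = - cos (2 * (PI / 5))).
  { replace (3 * (PI / 5)) with (- (2 * (PI / 5)) + PI) by field.
    rewrite neg_cos, cos_neg. reflexivity. }
  rewrite E2, E3 in E.
  (* The cubic is [(c + 1) (4 c^2 - 2 c - 1)]; the root [c = -1] is excluded by [c > 0]. *)
  assert (Hq : 4 * c * c - 2 * c - 1 = 0).
  { apply Rmult_eq_reg_l with (c + 1); lra. }
  pose proof (sqrt_pos 5). pose proof (sqrt_sqrt 5 ltac:(lra)) as Hs.
  assert (Hp : (4 * c - 1 - sqrt 5) * (4 * c - 1 + sqrt 5) = 0) by nra.
  apply Rmult_integral in Hp as [Hp|Hp]; [lra|].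
  exfalso. assert (2 < sqrt 5) by (pose proof sqrt5_bounds; lra). nra.
Qed.

Theorem theorem5p3 :
  forall (n : nat) (Theta : C -> C),
    unicritical_blaschke n Theta ->
    ((3 <= n)%nat ->
       cos (PI / 4) = (1 / sqrt 2)%R /\
       contains_pseudohyperbolic_disk
         (numerical_range (compressed_shift Theta)) (cos (PI / 4))) /\
    ((4 <= n)%nat ->
       cos (PI / 5) = (1 / 4 * (1 + sqrt 5))%R /\
       contains_pseudohyperbolic_disk
         (numerical_range (compressed_shift Theta)) (cos (PI / 5))).
Proof.
  intros n Theta (_ & lambda & z0 & Hl & Hz & HTheta).
  assert (Hl0 : lambda <> RtoC 0).
  { intros ->. rewrite Cmod_0 in Hl. lra. }
  assert (Hsub : forall m r, (m <= n)%nat ->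
    contains_pseudohyperbolic_disk (coef_range z0 m) r ->
    contains_pseudohyperbolic_disk (numerical_range (compressed_shift Theta)) r).
  { intros m r Hm (Hr & w0 & Hw0 & Hin). split; auto. exists w0. split; auto.
    intros w Hw. apply numerical_range_coef with lambda z0 n; auto.
    apply coef_range_sub with m; auto. }
  assert (HT : 0 <= Cmod z0 ^ 2) by apply pow2_ge_0.
  split; intros Hn.
  - split; [apply cos_PI4|]. apply Hsub with 3%nat; auto.
    rewrite cos_PI4.
    assert (Hs0 : 0 < sqrt 2) by (apply sqrt_lt_R0; lra).
    pose proof (sqrt_sqrt 2 ltac:(lra)) as Hs.
    assert (Hr : 1 / sqrt 2 = sqrt 2 / 2).
    { field_simplify_eq; [|lra]. simpl. lra. }
    rewrite Hr. apply coef_range3_contains; auto.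
    + nra.
    (* For this radius the condition reads [3 sqrt 2 <= 3 / 2 * sqrt (8 + |z0|^2)], an equality at
       [z0 = 0]. *)
    + assert (H : 2 * sqrt 2 <= sqrt (8 + Cmod z0 ^ 2)).
      { rewrite <- (sqrt_square (2 * sqrt 2)) by lra. apply sqrt_le_1_alt. nra. }
      replace ((sqrt 2 / 2) ^ 2) with (1 / 2) by (field [Hs]). lra.
  - split; [apply cos_PI5|]. rewrite cos_PI5.
    replace (1 / 4 * (1 + sqrt 5)) with ((1 + sqrt 5) / 4) by field.
    destruct (Rle_or_lt (Cmod z0 ^ 2) (5 / 8)) as [H|H].
    + apply Hsub with 4%nat; auto. apply coef_range4_contains; auto.
    + apply Hsub with 3%nat; [lia|]. apply coef_range3_contains; auto.
      * pose proof sqrt5_bounds. lra.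
      * apply golden_radius. lra.
Qed.
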